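(* Let $\epsilon>0$. There exists a constant $C=C(\epsilon)$ such that $|A(2,4,\mathcal{H})|\le C\mathcal{H}^{\epsilon}$ for all $\mathcal{H}\in\bar{\mathbb{Q}}\cap[1,\infty)$ with $[\mathbb{Q}(\mathcal{H}^4):\mathbb{Q}]=4$.
   Context: For algebraic $\alpha$ of degree $d$, with $a_0>0$ the leading coefficient of a minimal polynomial of $\alpha$ in $\mathbb{Z}[t]$ and conjugates $\alpha_1,\dots,\alpha_d$, $H(\alpha)=\big(a_0\prod_i\max\{1,|\alpha_i|\}\big)^{1/d}$ (absolute multiplicative Weil height). $A(k,d,\mathcal{H})=\{\alpha\in\mathbb{C}: [\mathbb{Q}(\alpha):\mathbb{Q}]=d,\ H(\alpha)=\mathcal{H},$ precisely $k$ conjugates of $\alpha$ in the open unit disk$\}$. *)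

(* Defs.v *)
From HB Require Import structures.
From mathcomp Require Import all_boot all_order all_algebra.
From mathcomp Require Import all_classical all_reals all_analysis.
From mathcomp Require Import complex.

Set Implicit Arguments.
Unset Strict Implicit.
Unset Printing Implicit Defensive.

Import Order.TTheory GRing.Theory Num.Theory.
Local Open Scope ring_scope.

Section AlgebraicHeight.
Variable R : realType.
Local Notation C := R[i].

Definition algebraic (z : C) : Prop :=
  exists p : {poly rat}, p != 0 /\ root (map_poly ratr p) z.

(* P is "the" minimal polynomial of z in Z[t]: primitive with positive
   leading coefficient (zcontents P = 1), irreducible over Q, vanishing at z. *)
Definition minpolyZ (z : C) (P : {poly int}) : Prop :=
  [/\ zcontents P = 1,
      irreducible_poly (map_poly intr P : {poly rat})
    & root (map_poly intr P : {poly C}) z].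

Definition alg_degree (z : C) (d : nat) : Prop :=
  exists P : {poly int}, minpolyZ z P /\ (size P).-1 = d.

Definition conjugates_of (P : {poly int}) (rs : seq C) : Prop :=
  (map_poly intr P : {poly C}) =
    (lead_coef P)%:~R *: \prod_(w <- rs) ('X - w%:P).

Definition weil_height_is (z : C) (h : R) : Prop :=
  exists (P : {poly int}) (rs : seq C),
    [/\ minpolyZ z P, conjugates_of P rs &
        h = ((lead_coef P)%:~R * \prod_(w <- rs) Num.max 1 (Normc.normc w))
              `^ (((size P).-1)%:R^-1)].

Definition inA (k d : nat) (H : R) (z : C) : Prop :=
  [/\ alg_degree z d, weil_height_is z H &
      exists (P : {poly int}) (rs : seq C),
        [/\ minpolyZ z P, conjugates_of P rs &
            count (fun w => Normc.normc w < 1) rs = k]].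

End AlgebraicHeight.

(* Main.v *)
(* Let P = a_0 (t - w_1) ... (t - w_4) be the minimal polynomial of an element of A(2, 4, H), with w_1, w_2 outside the open unit disk. Then w_1 w_2 is real and, for A = a_0 or A = - a_0, H^4 = A w_1 w_2 is a root of the resolvent of degree 6 with roots A w_i w_j (i < j), which has integer coefficients. Its minimal polynomial M has degree 4 by hypothesis, and its roots are stable under x |-> N / x for N = A^2 w_1 w_2 w_3 w_4 in Z; so, after exchanging w_3 and w_4, they are A w_1 w_2, A w_3 w_4, A w_1 w_4, A w_2 w_3, and the two remaining roots nu = A w_1 w_3 and nu' = A w_2 w_4 of the resolvent have an integer trace T. Now N^2 = M(0), A | N, nu nu' = N, |T| <= 2 H^4, and each root w of P satisfies w^2 = nu x / (A y) or w^2 = nu' x / (A y) with roots x, y of M. Moreover T^2 - 4 N lies in a square class depending only on M and N: T^2 - D y^2 = 4 N for a fixed squarefree D.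

   It remains to count such T. Elements x + y sqrt D of norm m are sorted by their content and by the divisor of m modulo which they agree with a fixed one; two elements in the same class differ by a unit (u + v sqrt D) / 2, and units at least double in size from one to the next. So the count is a divisor function times a logarithm, and tau(n) = O(n^eps). *)
Require Import Defs.
From HB Require Import structures.
From mathcomp Require Import all_boot all_order all_algebra all_field.
From mathcomp Require Import all_classical all_reals all_analysis.
From mathcomp Require Import complex.
From mathcomp Require Import zify ring lra.
Set Implicit Arguments.
Unset Strict Implicit.
Unset Printing Implicit Defensive.
Import Order.TTheory GRing.Theory Num.Theory.
Local Open Scope ring_scope.

(** * The divisor bound *)

Section DivisorBound.
Local Open Scope nat_scope.

Lemma leq_base_expn e m n : m <= n -> m ^ e <= n ^ e.
Proof. by case: e => // e; rewrite leq_exp2r. Qed.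

Definition tau n := size (divisors n).

(** A divisor d of m n is gcd(d, m) times d / gcd(d, m), and the second factor, being coprime to m /
    gcd(d, m), divides n. *)
Lemma tau_mul m n : 0 < m -> 0 < n -> tau (m * n) <= tau m * tau n.
Proof.
move=> m0 n0; rewrite /tau -(size_allpairs muln).
apply: uniq_leq_size (divisors_uniq _) _ => d; rewrite -dvdn_divisors ?muln_gt0 ?m0 // => dmn.
apply/allpairsP; exists (gcdn d m, d %/ gcdn d m) => /=.
have g0 : 0 < gcdn d m by rewrite gcdn_gt0 m0 orbT.
rewrite -!dvdn_divisors // dvdn_gcdr mulnC divnK ?dvdn_gcdl //; split=> //.
have co : coprime (d %/ gcdn d m) (m %/ gcdn d m).
  rewrite /coprime -(eqn_pmul2r g0) muln_gcdl !divnK ?dvdn_gcdl ?dvdn_gcdr //.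
  by rewrite mul1n.
rewrite -(Gauss_dvdr _ co) -(dvdn_pmul2r g0) divnK ?dvdn_gcdl //.
by rewrite mulnAC divnK ?dvdn_gcdr.
Qed.

Lemma tau_pfactor p k : prime p -> tau (p ^ k) <= k.+1.
Proof.
move=> pp; rewrite /tau -[leqRHS](size_iota 0) -[leqRHS](size_map (expn p)).
apply: uniq_leq_size (divisors_uniq _) _ => d.
rewrite -dvdn_divisors ?expn_gt0 ?prime_gt0 // => /(dvdn_pfactor _ _ pp)[i ik ->].
by apply: map_f; rewrite mem_iota.
Qed.

Lemma tau_dvd m n : 0 < n -> m %| n -> tau m <= tau n.
Proof.
move=> n0 mn; apply: uniq_leq_size (divisors_uniq _) _ => d.
by rewrite -!dvdn_divisors ?(dvdn_gt0 n0 mn) // => dm; apply: dvdn_trans mn.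
Qed.

(** With the integer quotient, k + 1 <= K (k / K + 1) <= K 2 ^ (k / K); then take K-th powers. *)
Lemma succ_exp_le K k : k.+1 ^ K <= K ^ K * 2 ^ k.
Proof.
case: K => [|K]; first by rewrite !expn0 mul1n expn_gt0.
apply: (@leq_trans ((K.+1 * 2 ^ (k %/ K.+1)) ^ K.+1)).
  rewrite leq_exp2r //; apply: leq_trans (_ : K.+1 * (k %/ K.+1).+1 <= _).
    by rewrite mulnC; apply: ltn_ceil.
  by rewrite leq_mul2l /= ltn_expl.
by rewrite expnMn leq_mul2l -expnM leq_exp2l // leq_divM orbT.
Qed.

(* Primes p >= 2 ^ K satisfy (k + 1) ^ K <= p ^ k and cost nothing; each of the finitely many smaller ones costs a factor K ^ K. *)
Lemma tau_expn_le_part K B : exists2 c, 0 < c & forall n, 0 < n ->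
  (forall p, prime p -> p %| n -> (p < B) || (2 ^ K <= p)) -> tau n ^ K <= c * n.
Proof.
(* B bounds the small primes still allowed. For B = 0 all prime factors are at least 2 ^ K and their
   powers are split off one by one; the step to B + 1 splits off the power of B. *)
elim: B => [|B [c c0 IH]].
  exists 1 => // n; elim/ltn_ind: n => n IH n0 np; rewrite mul1n.
  have [n1|n1] := leqP n 1.
    have -> : n = 1 by apply/eqP; rewrite eqn_leq n1.
    by rewrite /tau (_ : divisors 1 = [:: 1]) // exp1n.
  have pp := pdiv_prime n1; set p := pdiv n in pp.
  have pn : p %| n by apply: pdiv_dvd.
  have [m co En] := pfactor_coprime pp n0.
  have k0 : 0 < logn p n by rewrite logn_gt0 mem_primes pp n0.
  set k := logn p n in En k0.
  have pk1 : 1 < p ^ k by rewrite -(exp1n k) ltn_exp2r // prime_gt1.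
  have m0 : 0 < m by move: n0; rewrite En; case: (m).
  have mn : m < n by rewrite En ltn_Pmulr.
  rewrite En; apply: leq_trans (_ : (tau m * tau (p ^ k)) ^ K <= _).
    by apply: leq_base_expn; apply: tau_mul => //; apply: ltnW.
  rewrite expnMn; apply: leq_mul.
    rewrite -[leqRHS]mul1n; apply: IH => // q pq qm.
    by apply: np => //; rewrite En dvdn_mulr.
  apply: leq_trans (_ : k.+1 ^ K <= _).
    by apply: leq_base_expn; apply: tau_pfactor.
  apply: leq_trans (_ : (2 ^ k) ^ K <= _).
    by apply: leq_base_expn; apply: ltn_expl.
  by rewrite -expnM mulnC expnM; apply: leq_base_expn; have := np p pp pn.
exists (c * K ^ K).
  by rewrite muln_gt0 c0 /=; case: (K) => // ?; rewrite expn_gt0.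
move=> n n0 np.
have [pB|npB] := boolP (prime B); last first.
  apply: leq_trans (IH _ n0 _) _.
    move=> p pp pn; have /orP[|->] := np p pp pn; last by rewrite orbT.
    rewrite ltnS leq_eqVlt => /orP[/eqP pB|-> //].
    by rewrite pB (negPf npB) in pp.
  rewrite leq_mul2r; apply/orP; right; apply: leq_pmulr.
  by case: (K) => // ?; rewrite expn_gt0.
have [m co En] := pfactor_coprime pB n0.
set k := logn B n in En.
have m0 : 0 < m by move: n0; rewrite En; case: (m).
rewrite En; apply: leq_trans (_ : (tau m * tau (B ^ k)) ^ K <= _).
  by apply: leq_base_expn; apply: tau_mul; rewrite // expn_gt0 prime_gt0.
rewrite expnMn mulnACA; apply: leq_mul.
  apply: IH => // q pq qm.
  have qn : q %| n by rewrite En dvdn_mulr.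
  have /orP[|->] := np q pq qn; last by rewrite orbT.
  rewrite ltnS leq_eqVlt => /orP[/eqP qB|-> //].
  by move: co; rewrite -qB prime_coprime // qm.
apply: leq_trans (_ : k.+1 ^ K <= _).
  by apply: leq_base_expn; apply: tau_pfactor.
apply: leq_trans (succ_exp_le K k) _.
by rewrite leq_mul2l leq_base_expn ?orbT // prime_gt1.
Qed.

(** For B = 2 ^ K every prime is allowed. The K-th power expresses tau(n) = O(n ^ (1 / K)) within
    the natural numbers. *)
Lemma tau_expn_le K : exists2 c, 0 < c & forall n, 0 < n -> tau n ^ K <= c * n.
Proof.
have [c c0 Hc] := tau_expn_le_part K (2 ^ K); exists c => // n n0.
by apply: Hc => // p _ _; case: ltnP.
Qed.

Lemma trunc_log_expn_le K n : 0 < n -> (trunc_log 2 n).+1 ^ K <= K ^ K * n.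
Proof.
move=> n0; apply: leq_trans (succ_exp_le _ _) _.
by rewrite leq_mul2l trunc_logP ?orbT.
Qed.

End DivisorBound.

(** * Counting up to a finite fibre *)

Section AtMost.
Local Open Scope nat_scope.

(** A cardinality bound for an arbitrary predicate, with no finiteness or decidability
    presupposed. *)
Definition at_most (T : eqType) (P : T -> Prop) n :=
  forall s : seq T, uniq s -> (forall x, x \in s -> P x) -> size s <= n.

Lemma at_most_seq (T : eqType) (l : seq T) (P : T -> Prop) n :
  size l <= n -> (forall x, P x -> x \in l) -> at_most P n.
Proof.
by move=> ln Pl s us sP; apply: leq_trans ln; apply: uniq_leq_size => // x /sP/Pl.
Qed.

Lemma at_most1 (T : eqType) (P : T -> Prop) :
  (forall x y, P x -> P y -> x = y) -> at_most P 1.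
Proof.
move=> P1 [|x [|y s]] //= /andP[]; rewrite inE negb_or => /andP[/eqP xy _] _ sP.
by case: xy; apply: P1; apply: sP; rewrite !inE eqxx ?orbT.
Qed.

(** A duplicate-free list of elements of P is prolonged as long as some element is missing; it
    cannot reach length n + 1. *)
Lemma at_most_enum (T : eqType) (P : T -> Prop) n : at_most P n ->
  exists2 l : seq T, size l <= n & forall x, P x <-> x \in l.
Proof.
move=> Pn.
have H k : (exists2 l : seq T, size l <= n & forall x, P x <-> x \in l) \/
   exists l : seq T, [/\ uniq l, size l = k & forall x, x \in l -> P x].
  elim: k => [|k [IH|[l [ul sl lP]]]]; [by right; exists [::] | by left |].
  have [full|/existsNP[x /not_implyP[Px /negP xl]]] := EM (forall x, P x -> x \in l).
    by left; exists l => [|x]; [apply: Pn | split; [apply: full | apply: lP]].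
  right; exists (x :: l); split => /=; [by rewrite xl | by rewrite sl |].
  by move=> y; rewrite inE => /orP[/eqP->|/lP].
have [//|[l [ul sl lP]]] := H n.+1.
by have := Pn l ul lP; rewrite sl ltnn.
Qed.

Lemma at_most_bind (T U : eqType) (S : U -> Prop) (Q : U -> T -> Prop) (P : T -> Prop) n m :
  at_most S n -> (forall y, S y -> at_most (Q y) m) ->
  (forall x, P x -> exists2 y, S y & Q y x) -> at_most P (n * m).
Proof.
move=> /at_most_enum[l ln Sl] Qm PQ.
(* P is generalized because the induction step removes from it the elements related to the head of
   the list. *)
suff H (k : seq U) : (forall y, y \in k -> at_most (Q y) m) -> forall P : T -> Prop,
    (forall x, P x -> exists2 y, y \in k & Q y x) -> at_most P (size k * m).
  move=> s us sP; apply: leq_trans (_ : size l * m <= _); last by rewrite leq_mul2r ln orbT.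
  apply: H us sP; first by move=> y /Sl/Qm.
  by move=> x /PQ[y /Sl yl yx]; exists y.
elim: k {PQ Qm} => [|y k IH] Qm P' PQ s us sP.
  by case: s us sP => // x s _ sP; have [] := PQ x (sP x (mem_head _ _)).
rewrite /= mulSn -(count_predC (fun x => `[< Q y x >])); apply: leq_add.
  rewrite -size_filter; apply: (Qm y (mem_head _ _)); first exact: filter_uniq.
  by move=> x; rewrite mem_filter => /andP[/asboolP].
rewrite -size_filter; apply: (IH _ (fun x => P' x /\ ~ Q y x)).
- by move=> z zk; apply: Qm; rewrite inE zk orbT.
- move=> x [/PQ[z]]; rewrite inE => /orP[/eqP -> //|zk Qz _].
  by exists z.
- exact: filter_uniq.
- by move=> x; rewrite mem_filter /= => /andP[/asboolPn nQ /sP].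
Qed.

Lemma at_most_sub (T : eqType) (P Q : T -> Prop) n m :
  n <= m -> (forall x, P x -> Q x) -> at_most Q n -> at_most P m.
Proof. by move=> nm PQ Qn s us sP; apply: leq_trans nm; apply: Qn => // x /sP/PQ. Qed.

(** This makes a reference element of P available, to which the others can be compared. *)
Lemma at_most_witness (T : eqType) (P : T -> Prop) n :
  (forall x, P x -> at_most P n) -> at_most P n.
Proof. by move=> Pn [|x s] us sP //; exact: (Pn x (sP x (mem_head _ _)) (x :: s) us sP). Qed.

End AtMost.

(** * Elements of given norm in quadratic orders *)

Section QuadraticNorms.
Implicit Types D M N x y u v : int.

(** D may be negative or equal to 1; D = 0 is excluded, as every square divides it. *)
Definition squarefree D := forall e : int, (e * e %| D)%Z -> `|e|%N = 1%N.

Lemma squarefree_neq0 D : squarefree D -> D != 0.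
Proof. by move=> sD; apply/eqP => D0; have := sD 0; rewrite D0 dvdz0 => /(_ isT). Qed.

Lemma squarefree_decomposition N : N != 0 ->
  exists D g, [/\ squarefree D, g != 0 & N = D * (g * g)].
Proof.
have [k] := ubnP `|N|%N; elim: k N => // k IH N Nk N0.
have [sN|/existsNP[e /not_implyP[/dvdzP[q Nq] e1]]] := EM (squarefree N).
  by exists N, 1; rewrite !mulr1.
have e0 : e != 0 by apply: contra_neq N0 => e0; rewrite Nq e0 !mulr0.
have q0 : q != 0 by apply: contra_neq N0 => q0; rewrite Nq q0 mul0r.
have [|//|D [g [sD g0 qE]]] := IH q.
  have e2 : (2 <= `|e|)%N by lia.
  have q1 : (0 < `|q|)%N by lia.
  move: Nk; rewrite Nq !abszM; move: (`|q|)%N (`|e|)%N q1 e2 => a b a0 b2 abk.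
  have : (a * 4 <= a * (b * b))%N by rewrite leq_mul2l (leq_mul b2 b2) orbT.
  by lia.
by exists D, (g * e); split; rewrite ?mulf_neq0 // Nq qE; ring.
Qed.

Lemma coprimez_bezout x y u v : u * x + v * y = 1 -> coprimez x y.
Proof. by move=> E; apply/coprimezP; exists (u, v). Qed.

Lemma squarefree_dvd4 D e : squarefree D -> (e * e %| 4 * D)%Z -> (e %| 2)%Z.
Proof.
move=> sD; have [/dvdzP[f ->]|odd_e] := boolP (2 %| e)%Z.
  rewrite (_ : f * 2 * (f * 2) = 4 * (f * f)); last by ring.
  by rewrite dvdz_mul2l // => /sD f1; rewrite dvdzE abszM f1.
have co : coprimez (e * e) 4.
  rewrite (_ : 4 = 2 * 2) // !coprimezMr !coprimezMl !andbb coprimez_sym.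
  by rewrite coprimezE prime_coprime.
by rewrite Gauss_dvdzr // => /sD e1; rewrite dvdzE e1 dvd1n.
Qed.

(** Write D = D1 d and x = x1 d with d = gcd(D, x). Then D1 divides x1^2 d, hence d, so D1^2 divides
    D and D1 is a unit. *)
Lemma squarefree_dvd_sqr D x : squarefree D -> (D %| x * x)%Z -> (D %| x)%Z.
Proof.
move=> sD Dx; have D0 := squarefree_neq0 sD; set d := gcdz D x.
have d0 : d != 0 by rewrite gcdz_eq0 (negPf D0).
have /dvdzP[D1 DE] := dvdz_gcdl D x; have /dvdzP[x1 xE] := dvdz_gcdr D x.
rewrite -/d in DE xE.
have co : coprimez D1 x1.
  have := erefl d; rewrite {1}/d {1}DE {1}xE -mulz_gcdl (_ : `|d|%:Z = d) //.
  by rewrite -[RHS]mul1r => /(mulIf d0)/eqP.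
have D1d : (D1 %| d)%Z.
  move: Dx; rewrite {1}DE {1 2}xE (_ : x1 * d * _ = x1 * x1 * d * d); last by ring.
  by rewrite dvdz_mul2r // Gauss_dvdzr // coprimezMr co.
have /sD D11 : (D1 * D1 %| D)%Z by rewrite [X in (_ %| X)%Z]DE dvdz_mul.
by apply: dvdz_trans (dvdz_gcdr D x); rewrite -/d dvdzE {1}DE abszM D11 mul1n.
Qed.

(** Dividing by g^2 makes N D a square k^2, and the squarefree D divides k. *)
Lemma square_class D N g u : squarefree D -> g != 0 ->
  N * (D * (g * g)) = u * u -> exists f, N = D * (f * f).
Proof.
move=> sD g0 E; have D0 := squarefree_neq0 sD.
have /dvdzP[k uk] : (g %| u)%Z.
  by rewrite -(@dvdz_pexp2r _ _ 2) // !expr2 -E; apply/dvdz_mull/dvdz_mull.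
have E1 : N * D = k * k.
  by apply: (mulIf (mulf_neq0 g0 g0)); rewrite -mulrA E uk; ring.
have /(squarefree_dvd_sqr sD)/dvdzP[f kf] : (D %| k * k)%Z by rewrite -E1 dvdz_mull.
by exists f; apply: (mulIf D0); rewrite E1 kf; ring.
Qed.

Lemma coprimez_norm D M x y : coprimez x y -> x * x - D * (y * y) = M -> coprimez y M.
Proof.
move=> /coprimezP[[u v] /= uv] <-.
(* Square u x + v y = 1 and substitute x^2 = M + D y^2. *)
apply: (@coprimez_bezout _ _ (u * u * D * y + 2 * u * v * x + v * v * y) (u * u)).
by rewrite -[RHS](_ : (u * x + v * y) * (u * x + v * y) = 1); [ring | rewrite uv].
Qed.

Lemma dvdz_bezout_mul g h W e : gcdz g h = e -> (g %| W)%Z -> (h %| W)%Z -> (g * h %| e * W)%Z.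
Proof.
move=> <- gW hW; have [u [v <-]] := Bezoutz g h.
rewrite (_ : _ * W = g * (u * W) + (v * W) * h); last by ring.
by apply: rpredD; apply: dvdz_mul => //; apply: dvdz_mull.
Qed.

(* The key of (x1, y1) records modulo which part of M the residue x1 / y1 agrees with x0 / y0; on the complementary part it agrees with - x0 / y0. *)
Lemma same_key D M x0 y0 x1 y1 x2 y2 : squarefree D -> M != 0 ->
  x0 * x0 - D * (y0 * y0) = M -> x1 * x1 - D * (y1 * y1) = M ->
  x2 * x2 - D * (y2 * y2) = M ->
  coprimez x0 y0 -> coprimez x1 y1 -> coprimez x2 y2 ->
  gcdz (x1 * y0 - x0 * y1) M = gcdz (x2 * y0 - x0 * y2) M ->
  (M %| 2 * (x1 * y2 - x2 * y1))%Z.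
Proof.
move=> sD M0 E0 E1 E2 co0 co1 co2; set g := gcdz (x2 * _ - _) M => g1.
have c0 := coprimez_norm co0 E0; have c1 := coprimez_norm co1 E1.
have g0 : g != 0 by rewrite gcdz_eq0 (negPf M0) andbF.
have /dvdzP[h ME] : (g %| M)%Z by apply: dvdz_gcdr.
have hM : (h %| M)%Z by rewrite ME dvdz_mulr.
have gM : (g %| M)%Z by apply: dvdz_gcdr.
(* The product of x y0 - x0 y and x y0 + x0 y is M (y0^2 - y^2). As g is the whole gcd, h = M / g is
   coprime to (x y0 - x0 y) / g and must divide the other factor. *)
have compl x y : x * x - D * (y * y) = M -> gcdz (x * y0 - x0 * y) M = g ->
    (g %| x * y0 - x0 * y)%Z /\ (h %| x * y0 + x0 * y)%Z.
  move=> E gE; have /dvdzP[a aE] : (g %| x * y0 - x0 * y)%Z by rewrite -gE dvdz_gcdl.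
  split; first by rewrite aE dvdz_mull.
  have co : coprimez h a.
    have := gE; rewrite aE ME -mulz_gcdl (_ : `|g|%:Z = g) //.
    by rewrite -[RHS]mul1r => /(mulIf g0)/eqP; rewrite gcdzC.
  rewrite -(Gauss_dvdzr _ co) -(dvdz_mul2r g0) -ME.
  apply/dvdzP; exists (y0 * y0 - y * y).
  transitivity ((a * g) * (x * y0 + x0 * y)); first by ring.
  rewrite -aE (_ : _ * _ = x * x * (y0 * y0) - x0 * x0 * (y * y)); last by ring.
  by move: E E0 => /(canRL (subrK _)) -> /(canRL (subrK _)) ->; ring.
have [gA1 hB1] := compl _ _ E1 g1; have [gA2 hB2] := compl _ _ E2 erefl.
have gW : (g %| x1 * y2 - x2 * y1)%Z.
  have co : coprimez g y0 by apply: coprimez_dvdl gM _; rewrite coprimez_sym.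
  rewrite -(Gauss_dvdzr _ co).
  rewrite (_ : _ * _ = y2 * (x1 * y0 - x0 * y1) - y1 * (x2 * y0 - x0 * y2)); last by ring.
  by apply: rpredB; apply: dvdz_mull.
have hW : (h %| x1 * y2 - x2 * y1)%Z.
  have co : coprimez h y0 by apply: coprimez_dvdl hM _; rewrite coprimez_sym.
  rewrite -(Gauss_dvdzr _ co).
  rewrite (_ : _ * _ = y2 * (x1 * y0 + x0 * y1) - y1 * (x2 * y0 + x0 * y2)); last by ring.
  by apply: rpredB; apply: dvdz_mull.
(* The gcd e divides 2 x0, and e^2 divides g h = M; hence e^2 divides 4 D y0^2 = (2 x0)^2 - 4 M,
   where y0 is coprime to M. *)
have e2 : (gcdz g h %| 2)%Z.
  set e := gcdz g h; have [eg eh] : (e %| g)%Z /\ (e %| h)%Z by rewrite dvdz_gcdl dvdz_gcdr.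
  have ey0 : coprimez e y0.
    by apply: coprimez_dvdl (dvdz_trans eg gM) _; rewrite coprimez_sym.
  have ey1 : coprimez e y1.
    by apply: coprimez_dvdl (dvdz_trans eg gM) _; rewrite coprimez_sym.
  have /dvdzP[k ek] : (e %| 2 * x0)%Z.
    rewrite -(Gauss_dvdzl _ ey1).
    rewrite (_ : _ * y1 = (x1 * y0 + x0 * y1) - (x1 * y0 - x0 * y1)); last by ring.
    by apply: rpredB; [apply: dvdz_trans hB1 | apply: dvdz_trans gA1].
  apply: (squarefree_dvd4 sD).
  have co : coprimez (e * e) (y0 * y0) by rewrite !coprimezMr !coprimezMl ey0.
  rewrite -(Gauss_dvdzl _ co).
  rewrite (_ : 4 * D * _ = (2 * x0) * (2 * x0) - 4 * M); last by rewrite -E0; ring.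
  apply: rpredB; first by apply/dvdzP; exists (k * k); rewrite ek; ring.
  by rewrite ME dvdz_mull // dvdz_mul.
apply: dvdz_trans (_ : (gcdz g h * (x1 * y2 - x2 * y1) %| _)%Z); last exact: dvdz_mul.
by rewrite ME (mulrC h); apply: dvdz_bezout_mul.
Qed.

(** The quotient of x1 + y1 sqrt D by x2 + y2 sqrt D is (U - W sqrt D) / M. As U^2 - D W^2 = M^2,
    integrality of 2 W / M entails that of 2 U / M, so the quotient is (u + v sqrt D) / 2, of norm
    1. *)
Lemma same_key_unit D M x1 y1 x2 y2 : M != 0 ->
  x1 * x1 - D * (y1 * y1) = M -> x2 * x2 - D * (y2 * y2) = M ->
  (M %| 2 * (x1 * y2 - x2 * y1))%Z ->
  exists u v, [/\ u * u - D * (v * v) = 4, u * M = 2 * (x1 * x2 - D * (y1 * y2)),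
    2 * x1 = x2 * u + D * (y2 * v) & 2 * y1 = y2 * u + x2 * v].
Proof.
move=> M0 E1 E2 /dvdzP[w wE].
set U := x1 * x2 - D * (y1 * y2); set W := x1 * y2 - x2 * y1 in wE.
have UW : U * U - D * (W * W) = M * M by rewrite -{1}E1 -E2 /U /W; ring.
have /dvdzP[u uE] : (M %| 2 * U)%Z.
  rewrite -(@dvdz_pexp2r _ _ 2) // !expr2.
  rewrite (_ : 2 * U * _ = 4 * (M * M) + D * ((2 * W) * (2 * W))); last by rewrite -UW; ring.
  by apply/dvdzP; exists (4 + D * w * w); rewrite wE; ring.
exists u, (- w); split=> //.
- apply: (mulIf (mulf_neq0 M0 M0)).
  transitivity ((u * M) * (u * M) - D * ((w * M) * (w * M))); first by ring.
  by rewrite -uE -wE -UW; ring.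
- apply: (mulIf M0).
  transitivity (x2 * (u * M) - D * y2 * (w * M)); last by ring.
  by rewrite -uE -wE /U /W -{1}E2; ring.
- apply: (mulIf M0).
  transitivity (y2 * (u * M) - x2 * (w * M)); last by ring.
  by rewrite -uE -wE /U /W -{1}E2; ring.
Qed.

End QuadraticNorms.

(** * Units, and the number of solutions of a norm equation *)

Section QuadraticNormCount.
Implicit Types D M N x y u v : int.

(** The integer w = D v1 v2 satisfies w^2 = (u1 u2 - 4)^2 - 4 (u2 - u1)^2, hence |w| <= u1 u2 - 5.
    This gives 2 (2 u1 - u2) (2 u2 - u1) <= 9, but for u2 < 2 u1 the two factors in parentheses are
    at least 1 and 7. *)
Lemma pell_double D u1 v1 u2 v2 :
  u1 * u1 - D * (v1 * v1) = 4 -> u2 * u2 - D * (v2 * v2) = 4 ->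
  5 <= u1 -> u1 < u2 -> 2 * u1 <= u2.
Proof.
move=> E1 E2 u15 u12; rewrite leNgt; apply/negP => u21.
have wE : (D * v1 * v2) * (D * v1 * v2) = (u1 * u1 - 4) * (u2 * u2 - 4).
  by rewrite -{1}E1 -E2; ring.
move: (D * v1 * v2) wE => w wE.
have gap : (u1 * u2 - 4) * (u1 * u2 - 4) - w * w = 4 * ((u2 - u1) * (u2 - u1)).
  by rewrite wE; ring.
have uu : 25 <= u1 * u2 by nia.
have gap0 : 0 < (u2 - u1) * (u2 - u1) by rewrite mulr_gt0 // subr_gt0.
have wlt : `|w| < u1 * u2 - 4.
  by rewrite ltNge; apply/negP => le; nia.
have wle : w * w <= (u1 * u2 - 5) * (u1 * u2 - 5).
  have -> : w * w = `|w| * `|w| by rewrite -normrM ger0_norm // -expr2 sqr_ge0.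
  by apply: ler_pM => //; lia.
have : 2 * ((2 * u1 - u2) * (2 * u2 - u1)) <= 9.
  have -> : 2 * ((2 * u1 - u2) * (2 * u2 - u1))
      = w * w - (u1 * u2 - 5) * (u1 * u2 - 5) + 9 by rewrite wE; ring.
  by lia.
have : 1 * 7 <= (2 * u1 - u2) * (2 * u2 - u1) by apply: ler_pM => //; lia.
by lia.
Qed.

(** Four sign choices for (u, v), times the number of values of [key] in [pell_count]. *)
Definition unit_bound Y := (4 * (6 + trunc_log 2 Y))%N.

Lemma pell_count D Y : D != 0 ->
  at_most (fun p : int * int => p.1 * p.1 - D * (p.2 * p.2) = 4 /\ (`|p.1| <= Y)%N)
    (unit_bound Y).
Proof.
(* Each |u| < 5 has its own key; a larger |u| is keyed by its dyadic interval, which contains at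
   most one by [pell_double]. *)
move=> D0; pose key (a : nat) := (if a < 5 then a else 5 + trunc_log 2 a)%N.
have key_inj a1 a2 v1 v2 : a1%:Z * a1 - D * (v1 * v1) = 4 ->
    a2%:Z * a2 - D * (v2 * v2) = 4 -> key a1 = key a2 -> (a1 < a2)%N -> False.
  rewrite /key => E1 E2; case: ifP => a1s; case: ifP => a2s; try lia.
  move=> /addnI logE a12.
  have d12 : (2 * a1 <= a2)%N by have := pell_double E1 E2; lia.
  have := @trunc_log_max 2 a2 (trunc_log 2 a1).+1 isT.
  rewrite expnS logE ltnn (leq_trans _ d12) => [/(_ isT) //|].
  by rewrite leq_mul2l -logE trunc_logP //; lia.
have key_lt a : (a <= Y)%N -> (key a < 6 + trunc_log 2 Y)%N.
  rewrite /key => aY; case: ifP => a5; first by lia.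
  by rewrite ltn_add2l ltnS leq_trunc_log.
clearbody key; rewrite /unit_bound mulnC.
apply: (@at_most_bind _ nat (fun k => (k < 6 + trunc_log 2 Y)%N) (fun k p =>
    p.1 * p.1 - D * (p.2 * p.2) = 4 /\ key `|p.1|%N = k)).
- apply: (@at_most_seq _ (iota 0 (6 + trunc_log 2 Y))); first by rewrite size_iota.
  by move=> k kY; rewrite mem_iota.
- move=> k _; apply: at_most_witness => -[u0 v0] /= [E0 k0].
  apply: (@at_most_seq _ [seq (a, b) | a <- [:: u0; - u0], b <- [:: v0; - v0]]) => //.
  move=> [u v] /= [E ku].
  have sqz (z : int) : (`|z|%N)%:Z * `|z|%N = z * z.
    by rewrite !abszE -normrM ger0_norm // -expr2 sqr_ge0.
  have uE : `|u|%N = `|u0|%N.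
    have [lt|lt|//] := ltngtP `|u|%N `|u0|%N; exfalso.
      by apply: (key_inj _ _ v v0 _ _ (etrans ku (esym k0)) lt); rewrite sqz.
    by apply: (key_inj _ _ v0 v _ _ (etrans k0 (esym ku)) lt); rewrite sqz.
  have vE : v ^+ 2 == v0 ^+ 2.
    rewrite !expr2 -(inj_eq (mulfI D0)).
    have := sqz u; rewrite uE sqz => uu.
    by apply/eqP; lia.
  have um : u \in [:: u0; - u0] by rewrite !inE; lia.
  have vm : v \in [:: v0; - v0] by rewrite !inE -eqf_sqr.
  exact: (allpairs_f pair um vm).
- move=> [u v] /= [E uY]; exists (key `|u|%N) => //.
  exact: key_lt.
Qed.

(** The argument bounds |u| in [same_key_unit]: u M = 2 (x1 x2 - D y1 y2), where |x_i| <= X and |D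
    y_i^2| <= X^2 + |M|. *)
Definition key_bound X (M : int) := unit_bound (4 * (X * X) + 2 * `|M|)%N.

(** The keys relative to a first solution (x0, y0) are divisors of M; within one key every solution
    is a fixed one (x2, y2) times a unit. *)
Lemma primitive_norm_count D M X : squarefree D -> M != 0 ->
  at_most (fun p : int * int => [/\ p.1 * p.1 - D * (p.2 * p.2) = M,
      coprimez p.1 p.2 & (`|p.1| <= X)%N]) (tau `|M|%N * key_bound X M).
Proof.
move=> sD M0; have D0 := squarefree_neq0 sD.
apply: at_most_witness => -[x0 y0] /= [E0 co0 _].
apply: (@at_most_bind _ nat (fun g => g \in divisors `|M|%N) (fun g p =>
    [/\ p.1 * p.1 - D * (p.2 * p.2) = M, coprimez p.1 p.2, (`|p.1| <= X)%N
      & gcdz (p.1 * y0 - x0 * p.2) M = g])).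
- exact: (@at_most_seq _ (divisors `|M|%N)).
- move=> g _; apply: at_most_witness => -[x2 y2] /= [E2 co2 X2 g2].
  rewrite -[key_bound _ _]muln1 /key_bound.
  have pc := @pell_count D (4 * (X * X) + 2 * `|M|)%N D0.
  apply: (at_most_bind pc (Q := fun q p : int * int =>
    2 * p.1 = x2 * q.1 + D * (y2 * q.2) /\ 2 * p.2 = y2 * q.1 + x2 * q.2)).
    move=> [u v] _; apply: at_most1 => -[x y] [x' y'] /= [e1 e2] [e3 e4].
    by congr (_, _); lia.
  move=> [x1 y1] /= [E1 co1 X1 g1].
  have [|u [v [uv uM e1 e2]]] := same_key_unit M0 E1 E2.
    by apply: same_key sD M0 E0 E1 E2 co0 co1 co2 _; rewrite g1 g2.
  exists (u, v) => //=; split=> //.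
  have Dy x y : x * x - D * (y * y) = M -> (`|x| <= X)%N -> `|D * (y * y)| <= (X * X + `|M|)%N.
    move=> E xX; have -> : D * (y * y) = x * x - M by rewrite -E; ring.
    apply: le_trans (ler_normB _ _) _; rewrite PoszD abszE lerD2r normrM PoszM.
    by apply: ler_pM => //; lia.
  have Dyy : `|D * (y1 * y2)| <= (X * X + `|M|)%N.
    rewrite -(@ler_pXn2r _ 2) ?nnegrE // -normrX.
    have -> : (D * (y1 * y2)) ^+ 2 = (D * (y1 * y1)) * (D * (y2 * y2)) by ring.
    by rewrite normrM expr2; apply: ler_pM => //; [apply: Dy E1 X1 | apply: Dy E2 X2].
  have xx : `|x1 * x2| <= (X * X)%N by rewrite normrM PoszM; apply: ler_pM => //; lia.
  have UB : `|x1 * x2 - D * (y1 * y2)| <= (X * X)%N%:Z + (X * X + `|M|)%N%:Z.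
    by apply: le_trans (ler_normB _ _) _; apply: lerD.
  have uMB : `|u| * `|M| <= 2 * ((X * X)%N%:Z + (X * X + `|M|)%N%:Z).
    by rewrite -normrM uM normrM ler_wpM2l.
  have : `|u| * 1 <= `|u| * `|M| by apply: ler_pM => //; lia.
  by move: uMB; move: (X * X)%N => XX; lia.
- move=> [x y] /= [E co xX]; exists `|gcdz (x * y0 - x0 * y) M|%N; last by split.
  by rewrite -dvdn_divisors ?absz_gt0 // -[(_ %| _)%N]/(_ %| M)%Z dvdz_gcdr.
Qed.

(** The first divisor is the content c of (x, y); what remains is a primitive solution for M' = M /
    c^2, whose bound is at most that for M. *)
Lemma norm_count D M X : squarefree D -> M != 0 ->
  at_most (fun p : int * int => p.1 * p.1 - D * (p.2 * p.2) = M /\ (`|p.1| <= X)%N)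
    (tau `|M|%N * (tau `|M|%N * key_bound X M)).
Proof.
move=> sD M0.
apply: (@at_most_bind _ nat (fun c => c \in divisors `|M|%N) (fun (c : nat) (p : int * int) =>
    exists x y : int, [/\ p = (c%:Z * x, c%:Z * y), c != 0%N, coprimez x y,
      c%:Z * c * (x * x - D * (y * y)) = M & (`|(c%:Z * x)%R| <= X)%N])).
- exact: (@at_most_seq _ (divisors `|M|%N)).
- move=> c _; apply: at_most_witness => _ [x0 [y0 [_ c0 _ E0 _]]].
  set M' := x0 * x0 - D * (y0 * y0) in E0.
  have c0' : c%:Z != 0 by [].
  have M'0 : M' != 0 by apply: contra_neq M0 => M'0; rewrite -E0 M'0 mulr0.
  have M'M : (`|M'| %| `|M|)%N by rewrite -E0 abszM dvdn_mull.
  have := @primitive_norm_count D M' X sD M'0 => Hp.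
  apply: (@at_most_sub _ _ _ _ _ _ _ (at_most_bind (m := 1%N) Hp
    (Q := fun q p : int * int => p = (c%:Z * q.1, c%:Z * q.2)) _ _)).
  + rewrite muln1; apply: leq_mul; first by rewrite tau_dvd ?absz_gt0.
    rewrite leq_mul2l; apply/orP; right; rewrite leq_add2l leq_trunc_log //.
    by rewrite leq_add2l leq_mul2l dvdn_leq // absz_gt0.
  + by move=> p; apply.
  + by move=> q _; apply: at_most1 => p p' -> ->.
  + move=> _ [x [y [-> _ co E xX]]]; exists (x, y) => //=; split=> //.
      by apply: (mulfI (mulf_neq0 c0' c0')); rewrite E E0.
    by apply: leq_trans xX; rewrite abszM; move: c0; case: (c) => // k _; lia.
- move=> [x y] /= [E xX].
  have g0 : gcdz x y != 0.
    rewrite gcdz_eq0; apply: contra_neqN M0 => /andP[/eqP x0 /eqP y0].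
    by rewrite -E x0 y0 !mulr0 subr0.
  have /dvdzP[x' xE] := dvdz_gcdl x y; have /dvdzP[y' yE] := dvdz_gcdr x y.
  have gN : (`|gcdz x y|%N)%:Z = gcdz x y by [].
  have E' : gcdz x y * gcdz x y * (x' * x' - D * (y' * y')) = M.
    rewrite -E; transitivity ((x' * gcdz x y) * (x' * gcdz x y)
      - D * ((y' * gcdz x y) * (y' * gcdz x y))); first by ring.
    by rewrite -xE -yE.
  exists `|gcdz x y|%N.
    by rewrite -dvdn_divisors ?absz_gt0 // -E' abszM abszM -mulnA dvdn_mulr.
  exists x', y'; rewrite gN; split=> //.
  + by congr (_, _); rewrite mulrC.
  + have : gcdz x y = gcdz x' y' * gcdz x y by rewrite -{2}gN mulz_gcdl -xE -yE.
    by rewrite -{1}[gcdz x y]mul1r => /(mulIf g0) e1; rewrite /coprimez -e1.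
  + by rewrite mulrC -xE.
Qed.

Lemma trace_count D M X : squarefree D -> M != 0 ->
  at_most (fun x : int => (exists y, x * x - D * (y * y) = M) /\ (`|x| <= X)%N)
    (tau `|M|%N * (tau `|M|%N * key_bound X M)).
Proof.
move=> sD M0; rewrite -[X in at_most _ X]muln1.
apply: (at_most_bind (@norm_count D M X sD M0) (Q := fun (p : int * int) x => x = p.1)).
  by move=> p _; apply: at_most1 => x x' -> ->.
by move=> x [[y E] xX]; exists (x, y).
Qed.

End QuadraticNormCount.

(** * The resolvent of a quartic *)

Section IntegerPolynomials.
Variable F : numFieldType.
Implicit Types p q : {poly int}.

Local Notation pZtoQ := (map_poly (intr : int -> rat)).
Local Notation pZtoF := (map_poly (intr : int -> F)).

Lemma map_intr_ratr p : pZtoF p = map_poly ratr (pZtoQ p).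
Proof. by rewrite -map_poly_comp; apply: eq_map_poly => x /=; rewrite ratr_int. Qed.

Lemma irreducible_root_dvdp p q z : irreducible_poly (pZtoQ p) ->
  root (pZtoF p) z -> root (pZtoF q) z -> pZtoQ p %| pZtoQ q.
Proof.
move=> irr pz qz; apply: contraLR qz; rewrite -irreducible_poly_coprime //.
rewrite -(coprimep_map (@ratr F)) -!map_intr_ratr => co.
exact: coprimep_root co pz.
Qed.

(** Gauss's lemma: the quotient over Q by the primitive p is integral. *)
Lemma irreducible_root_factor p q z : irreducible_poly (pZtoQ p) -> zcontents p = 1 ->
  root (pZtoF p) z -> root (pZtoF q) z -> exists r, q = p * r.
Proof.
move=> irr cp pz qz; have := irreducible_root_dvdp irr pz qz.
rewrite dvdp_rat_int => /dvdpP_int[r ->]; exists r.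
by rewrite {2}[p]zpolyEprim cp scale1r.
Qed.

Lemma irreducible_root_size p q z : irreducible_poly (pZtoQ p) ->
  root (pZtoF p) z -> root (pZtoF q) z -> q != 0 -> (size p <= size q)%N.
Proof.
move=> irr pz qz q0; have := irreducible_root_dvdp irr pz qz.
move/dvdp_leq; rewrite !size_rat_int_poly; apply.
by rewrite -size_poly_eq0 size_rat_int_poly size_poly_eq0.
Qed.

(** The cofactor is constant by degree, and it is 1 because [zcontents] carries the sign of the
    leading coefficient. *)
Lemma primitive_irreducible_eq p q z :
  irreducible_poly (pZtoQ p) -> zcontents p = 1 -> root (pZtoF p) z ->
  irreducible_poly (pZtoQ q) -> zcontents q = 1 -> root (pZtoF q) z -> p = q.
Proof.
move=> irrp cp pz irrq cq qz.
have [r qE] := irreducible_root_factor irrp cp pz qz.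
have p0 : p != 0 by rewrite -zcontents_eq0 cp.
have q0 : q != 0 by rewrite -zcontents_eq0 cq.
have r0 : r != 0 by apply: contra_neq q0 => r0; rewrite qE r0 mulr0.
have := irreducible_root_size irrq qz pz p0.
rewrite qE size_mul // => szr.
have /size_poly1P[c _ rE] : size r == 1%N.
  have r1 : (0 < size r)%N by rewrite size_poly_gt0.
  have p1 : (0 < size p)%N by rewrite size_poly_gt0.
  by rewrite eqn_leq r1 andbT; move: szr p1; case: (size p) => [//|m]; rewrite addSn -[m.+1]addn1 leq_add2l.
have : zcontents q = zcontents p * (c * zcontents 1).
  by rewrite -zcontentsZ -zcontentsM qE rE -mul_polyC mulr1.
rewrite cp cq zcontents_monic ?monic1 // mul1r mulr1 => c1.
by rewrite rE -c1 mulr1.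
Qed.

(** In characteristic 0 the derivative is nonzero of smaller degree, hence coprime to p. *)
Lemma irreducible_uniq_roots p c (rs : seq F) : irreducible_poly (pZtoQ p) ->
  c != 0 -> pZtoF p = c *: \prod_(w <- rs) ('X - w%:P) -> uniq rs.
Proof.
move=> irr c0 pE; rewrite -separable_prod_XsubC.
rewrite -(eqp_separable (eqp_scale _ c0)) -pE map_intr_ratr separable_map.
rewrite unlock irreducible_poly_coprime //.
have p0 := irredp_neq0 irr; have [p1 _] := irr.
apply/negP => /dvdp_leq; rewrite leqNgt lt_size_deriv // => H; suff /H : (pZtoQ p)^`() != 0 by [].
apply/eqP => /(congr1 (fun q : {poly rat} => q`_((size (pZtoQ p)).-2))); rewrite coef_deriv coef0.
move: p1 p0; rewrite -lead_coef_eq0 /lead_coef; case: (size _) => // -[|m] //= _ p0.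
by move/eqP; rewrite mulrn_eq0 (negPf p0).
Qed.

End IntegerPolynomials.

Section Quartic.
Variable F : numClosedFieldType.
Implicit Types P M : {poly int}.

Local Notation pZtoQ := (map_poly (intr : int -> rat)).
Local Notation pZtoF := (map_poly (intr : int -> F)).

Lemma coef_prod4 (a b c d : F) (s := [:: a; b; c; d]) (p := \prod_(w <- s) ('X - w%:P)) :
  [/\ p`_0 = a * b * c * d,
      p`_1 = - (a * b * c + a * b * d + a * c * d + b * c * d),
      p`_2 = a * b + a * c + a * d + b * c + b * d + c * d
    & p`_3 = - (a + b + c + d)].
Proof.
have -> : p = 'X^4 - (a + b + c + d)%:P * 'X^3
    + (a * b + a * c + a * d + b * c + b * d + c * d)%:P * 'X^2
    - (a * b * c + a * b * d + a * c * d + b * c * d)%:P * 'X + (a * b * c * d)%:P.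
  by rewrite /p /s !big_cons big_nil !polyCD !polyCM; ring.
by rewrite !(coefD, coefN, coefCM, coefXn, coefX, coefC) /=; split; ring.
Qed.

(* The monic polynomial whose roots are the six products A w_i w_j (i < j), for P = A (X - w_1) ... (X - w_4). *)
Definition pair_resolvent P : {poly int} :=
  let N := P`_4 * P`_0 in
  'X^6 - P`_2 *: 'X^5 + (P`_3 * P`_1 - N) *: 'X^4
  + (2 * P`_2 * N - P`_4 * P`_1 * P`_1 - P`_3 * P`_3 * P`_0) *: 'X^3
  + (N * (P`_3 * P`_1 - N)) *: 'X^2 - (P`_2 * N * N) *: 'X + (N * N * N)%:P.

Lemma pair_resolventE P (w1 w2 w3 w4 : F) (A : F := (P`_4)%:~R) :
  pZtoF P = A *: \prod_(w <- [:: w1; w2; w3; w4]) ('X - w%:P) ->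
  pZtoF (pair_resolvent P) = \prod_(w <- [:: A * w1 * w2; A * w3 * w4; A * w1 * w4;
     A * w2 * w3; A * w1 * w3; A * w2 * w4]) ('X - w%:P).
Proof.
move=> PE; have [c0 c1 c2 c3] := coef_prod4 w1 w2 w3 w4.
have cP i : (P`_i)%:~R = A * (\prod_(w <- [:: w1; w2; w3; w4]) ('X - w%:P))`_i.
  by rewrite -coefZ -PE coef_map.
rewrite /pair_resolvent !(rmorphD, rmorphN) /= !map_polyZ !map_polyXn map_polyX map_polyC /=.
rewrite !(rmorphM, rmorphB, rmorphN) /= -/A !cP c0 c1 c2 c3 !big_cons big_nil -!mul_polyC.
rewrite !(polyCM, polyCD, polyCN); ring.
Qed.

End Quartic.

(** * Factorization of the resolvent *)

Section QuarticResolvent.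
Variable F : numClosedFieldType.
Implicit Types P M : {poly int}.

Local Notation pZtoQ := (map_poly (intr : int -> rat)).
Local Notation pZtoF := (map_poly (intr : int -> F)).

Variables (P M : {poly int}) (w1 w2 w3 w4 : F).
Local Notation A := ((P`_4)%:~R : F).
Local Notation N := (P`_4 * P`_0).

Hypothesis P_roots : pZtoF P = A *: \prod_(w <- [:: w1; w2; w3; w4]) ('X - w%:P).
Hypothesis P4_neq0 : P`_4 != 0.
Hypothesis P0_neq0 : P`_0 != 0.
Hypothesis M_irr : irreducible_poly (pZtoQ M).
Hypothesis M_primitive : zcontents M = 1.
Hypothesis M_size : size M = 5%N.
Hypothesis M_root : root (pZtoF M) (A * w1 * w2).

Let A0 : A != 0. Proof. by rewrite intr_eq0. Qed.

Let N0 : (N%:~R : F) != 0. Proof. by rewrite intr_eq0 mulf_neq0. Qed.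

Lemma norm_P_roots : N%:~R = A * A * (w1 * w2 * w3 * w4).
Proof.
have [c0 _ _ _] := coef_prod4 w1 w2 w3 w4.
have : (P`_0)%:~R = A * (w1 * w2 * w3 * w4) by rewrite -c0 -coefZ -P_roots coef_map.
by rewrite rmorphM /= => ->; ring.
Qed.

Let w_neq0 : w1 * w2 * w3 * w4 != 0.
Proof. by apply: contra_neq N0 => w0; rewrite norm_P_roots w0 mulr0. Qed.

Local Notation L := [:: A * w1 * w2; A * w3 * w4; A * w1 * w4;
     A * w2 * w3; A * w1 * w3; A * w2 * w4].

Lemma resolvent_factor : exists (T c : int) (rM : seq F),
  [/\ pZtoF M = \prod_(w <- rM) ('X - w%:P), size rM = 4%N, uniq rM,
    pZtoF (pair_resolvent P) = pZtoF M * pZtoF ('X^2 - T *: 'X + c%:P)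
  & T%:~R + \sum_(w <- rM) w = \sum_(w <- L) w].
Proof.
have RE := pair_resolventE P_roots.
have [|Q RQ] := irreducible_root_factor (q := pair_resolvent P) M_irr M_primitive M_root.
  by rewrite RE root_prod_XsubC mem_head.
have sizeF p : size (pZtoF p) = size p by apply: size_map_inj_poly => //; apply: intr_inj.
have R_size : size (pair_resolvent P) = 7%N by rewrite -sizeF RE size_prod_XsubC.
have M0 : M != 0 by rewrite -size_poly_eq0 M_size.
have Q0 : Q != 0 by apply: contra_eq_neq R_size => Q0; rewrite RQ Q0 mulr0 size_poly0.
have Q_size : size Q = 3%N by move: R_size; rewrite RQ size_mul // M_size addSn /= => -[].
have M_monic : lead_coef M = 1.
  have : lead_coef M * lead_coef Q = 1.
    apply/eqP; rewrite -lead_coefM -RQ -(inj_eq (@intr_inj F)).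
    by rewrite -lead_coef_map_inj ?RE ?lead_coef_prod_XsubC //; apply: intr_inj.
  have : 0 < lead_coef M by rewrite -sgz_gt0 -sgz_contents M_primitive.
  move=> lM lMQ; have : (lead_coef M %| 1)%Z by apply/dvdzP; exists (lead_coef Q); rewrite mulrC.
  by rewrite dvdz1; lia.
have Q_monic : lead_coef Q = 1.
  apply/eqP; rewrite -[lead_coef Q]mul1r -{1}M_monic -lead_coefM -RQ -(inj_eq (@intr_inj F)).
  by rewrite -lead_coef_map_inj ?RE ?lead_coef_prod_XsubC //; apply: intr_inj.
have lead_map p : lead_coef (pZtoF p) = (lead_coef p)%:~R.
  by rewrite lead_coef_map_inj //; apply: intr_inj.
have [rM rME] := closed_field_poly_normal (pZtoF M).
have [rQ rQE] := closed_field_poly_normal (pZtoF Q).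
rewrite lead_map M_monic scale1r in rME; rewrite lead_map Q_monic scale1r in rQE.
have {}rME : pZtoF M = \prod_(w <- rM) ('X - w%:P) := rME.
have {}rQE : pZtoF Q = \prod_(w <- rQ) ('X - w%:P) := rQE.
have rM_size : size rM = 4%N.
  by have := congr1 (fun p : {poly F} => size p) rME; rewrite sizeF M_size size_prod_XsubC => -[].
have rQ_size : size rQ = 2%N.
  by have := congr1 (fun p : {poly F} => size p) rQE; rewrite sizeF Q_size size_prod_XsubC => -[].
have Q_coef : Q = 'X^2 - (- Q`_1) *: 'X + (Q`_0)%:P.
  apply/polyP => -[|[|[|i]]]; rewrite !(coefD, coefN, coefZ, coefXn, coefX, coefC) /=; try ring.
    have -> : Q`_2 = 1 by move: Q_monic; rewrite /lead_coef Q_size.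
    by ring.
  by rewrite nth_default ?Q_size // !(mulr0, subr0, addr0).
exists (- Q`_1), Q`_0, rM; split=> //.
- by apply: (irreducible_uniq_roots M_irr (oner_neq0 F)); rewrite scale1r.
- by rewrite -Q_coef RQ rmorphM.
have perm_L : perm_eq (rM ++ rQ) L.
  by apply: prod_XsubC_eq; rewrite -RE RQ rmorphM /= big_cat /= -rME -rQE.
rewrite -(perm_big _ perm_L) /= big_cat /= addrC; congr (_ + _).
have : (Q`_1)%:~R = (pZtoF Q)`_1 by rewrite coef_map.
rewrite rmorphN /= => ->; rewrite rQE; case: rQ rQ_size {rQE perm_L} => [|a [|b []]] // _.
by rewrite !big_cons !big_nil !(mulr1, addr0) mulrBl !mulrBr !(coefB, coefCM, coefMC, coefXM, coefX, coefC) /=; ring.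
Qed.

(* x |-> N / x permutes the roots of the resolvent, and it cannot move a root of M to the quadratic cofactor, as M is irreducible of degree 4. *)
Lemma M_root_inv x : root (pZtoF M) x -> root (pZtoF M) (N%:~R / x) /\ N%:~R / x != x.
Proof.
have [T [c [rM [ME _ _ RM _]]]] := resolvent_factor => Mx.
have no_small q : root (pZtoF q) x -> (size q <= 3)%N -> q = 0.
  move=> qx qs; apply/eqP; apply: contraTT qs => q0.
  by rewrite -ltnNge; have := irreducible_root_size M_irr Mx qx q0; rewrite M_size; apply: leq_trans.
have xL : x \in L.
  by rewrite -root_prod_XsubC -(pair_resolventE P_roots) RM rootM Mx.
have x0 : x != 0.
  move: xL; apply: contraTneq => ->; move: w_neq0; rewrite !mulf_eq0 !negb_or.
  move=> /andP[/andP[/andP[h1 h2] h3] h4].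
  by rewrite ![0 == _]eq_sym !mulf_eq0 (negPf A0) (negPf h1) (negPf h2) (negPf h3) (negPf h4).
have size3 (a b e : int) : (size (a *: 'X^2 + b *: 'X + e%:P)%R <= 3)%N.
  apply: leq_trans (size_polyD _ _) _; rewrite geq_max; apply/andP; split.
    apply: leq_trans (size_polyD _ _) _; rewrite geq_max; apply/andP; split.
      by apply: leq_trans (size_scale_leq _ _) _; rewrite size_polyXn.
    by apply: leq_trans (size_scale_leq _ _) _; rewrite size_polyX.
  by apply: leq_trans (size_polyC_leq1 _) _.
have eval3 (a b e : int) z : (pZtoF (a *: 'X^2 + b *: 'X + e%:P)).[z] =
    a%:~R * z ^+ 2 + b%:~R * z + e%:~R.
  by rewrite !rmorphD /= !map_polyZ /= map_polyXn map_polyX map_polyC !hornerE.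
split; last first.
  apply/eqP => xx; have : (1 *: 'X^2 + 0 *: 'X + (- N)%:P : {poly int}) = 0.
    apply: no_small (size3 _ _ _); rewrite rootE eval3 mul0r addr0 mul1r rmorphN /=.
    by rewrite -[X in _ - X](divfK x0) xx expr2 subrr.
  move/(congr1 (fun q : {poly int} => q`_2)).
  by rewrite !(coefD, coefN, coefZ, coefXn, coefX, coefC).
have : root (pZtoF (pair_resolvent P)) (N%:~R / x).
  rewrite (pair_resolventE P_roots) root_prod_XsubC norm_P_roots.
  move: w_neq0; rewrite !mulf_eq0 !negb_or => /andP[/andP[/andP[h1 h2] h3] h4].
  move: xL; rewrite !inE => /or4P[/eqP->|/eqP->|/eqP->|/or3P[/eqP->|/eqP->|/eqP->]].
  - by apply/or4P/Or42/eqP; field; rewrite A0 h1 h2.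
  - by apply/or4P/Or41/eqP; field; rewrite A0 h3 h4.
  - by apply/or4P/Or44; apply/or3P/Or31/eqP; field; rewrite A0 h1 h4.
  - by apply/or4P/Or43/eqP; field; rewrite A0 h2 h3.
  - by apply/or4P/Or44; apply/or3P/Or33/eqP; field; rewrite A0 h1 h3.
  - by apply/or4P/Or44; apply/or3P/Or32/eqP; field; rewrite A0 h2 h4.
rewrite RM rootM => /orP[//|].
rewrite (_ : 'X^2 - T *: 'X + c%:P = 1 *: 'X^2 + (- T) *: 'X + c%:P); last first.
  by rewrite scale1r scaleNr.
rewrite rootE eval3 => /eqP Qx.
(* This is X^2 times the cofactor evaluated at N / X. It vanishes at x, so it would be zero, but its
   constant term is N^2. *)
have : (c *: 'X^2 + (- T * N) *: 'X + (N * N)%:P : {poly int}) = 0.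
  apply: no_small (size3 _ _ _); rewrite rootE eval3; apply/eqP.
  transitivity (x ^+ 2 * (1%:~R * (N%:~R / x) ^+ 2 + (- T)%:~R * (N%:~R / x) + c%:~R)).
    by rewrite !(rmorphM, rmorphN) /=; field.
  by rewrite Qx mulr0.
move/(congr1 (fun q : {poly int} => q`_0)).
rewrite !(coefD, coefN, coefZ, coefXn, coefX, coefC) /= !mulr0 !add0r => /eqP.
by rewrite !mulf_eq0 (negPf P4_neq0) (negPf P0_neq0).
Qed.

(** M has four distinct roots, so one of them, y, is neither A w1 w2 nor A w3 w4. Then y or its
    partner N / y is A w1 w4 or A w1 w3. *)
Lemma resolvent_third_root : root (pZtoF M) (A * w1 * w4) \/ root (pZtoF M) (A * w1 * w3).
Proof.
have [T [c [rM [ME rM_size rM_uniq RM _]]]] := resolvent_factor.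
move: (w_neq0); rewrite !mulf_eq0 !negb_or => /andP[/andP[/andP[h1 h2] h3] h4].
have : ~~ all (mem [:: A * w1 * w2; A * w3 * w4]) rM.
  by apply/negP => /allP /(uniq_leq_size rM_uniq); rewrite rM_size.
rewrite -has_predC => /hasP[y yM /=]; rewrite !inE negb_or => /andP[y12 y34].
have My : root (pZtoF M) y by rewrite ME root_prod_XsubC.
have : y \in L by rewrite -root_prod_XsubC -(pair_resolventE P_roots) RM rootM My.
rewrite !inE (negPf y12) (negPf y34) /= => /or4P[]/eqP yE; move: My; rewrite yE; [by left| | by right|].
- move=> /M_root_inv[+ _]; rewrite norm_P_roots.
  have -> : A * A * (w1 * w2 * w3 * w4) / (A * w2 * w3) = A * w1 * w4.
    by field; rewrite A0 h2 h3.
  by left.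
- move=> /M_root_inv[+ _]; rewrite norm_P_roots.
  have -> : A * A * (w1 * w2 * w3 * w4) / (A * w2 * w4) = A * w1 * w3.
    by field; rewrite A0 h2 h4.
  by right.
Qed.

Hypothesis w_uniq : uniq [:: w1; w2; w3; w4].

(** Complementary products differ because N / x != x, the others because the w_i are distinct. So
    these four are all the roots of M, and T is the sum of the two products left over. *)
Lemma resolvent_pairs : root (pZtoF M) (A * w1 * w4) ->
  pZtoF M = \prod_(w <- [:: A * w1 * w2; A * w3 * w4; A * w1 * w4; A * w2 * w3]) ('X - w%:P)
  /\ exists T : int, T%:~R = A * w1 * w3 + A * w2 * w4.
Proof.
move=> M14; have [T [c [rM [ME rM_size rM_uniq _ sumE]]]] := resolvent_factor.
move: (w_neq0); rewrite !mulf_eq0 !negb_or => /andP[/andP[/andP[h1 h2] h3] h4].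
have [M34 ne34] := M_root_inv M_root; have [M23 ne23] := M_root_inv M14.
have E34 : N%:~R / (A * w1 * w2) = A * w3 * w4.
  by rewrite norm_P_roots; field; rewrite A0 h1 h2.
have E23 : N%:~R / (A * w1 * w4) = A * w2 * w3.
  by rewrite norm_P_roots; field; rewrite A0 h1 h4.
rewrite E34 in M34 ne34; rewrite E23 in M23 ne23.
move: w_uniq; rewrite /= !inE !negb_or => /and4P[/and3P[ne12 ne13 ne14] /andP[n23 ne24] n34 _].
have cancel (a x y : F) : a != 0 -> x != y -> a * x != a * y.
  by move=> a0; apply: contra_neq => /(mulfI a0).
have s_uniq : uniq [:: A * w1 * w2; A * w3 * w4; A * w1 * w4; A * w2 * w3].
  have Aw1 : A * w1 != 0 by rewrite mulf_neq0.
  have Aw2 : A * w2 != 0 by rewrite mulf_neq0.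
  have Aw3 : A * w3 != 0 by rewrite mulf_neq0.
  have Aw4 : A * w4 != 0 by rewrite mulf_neq0.
  have d1214 := cancel _ _ _ Aw1 ne24.
  have d1223 : A * w1 * w2 != A * w2 * w3 by rewrite mulrAC cancel.
  have d3414 : A * w3 * w4 != A * w1 * w4 by rewrite ![_ * w4]mulrAC cancel // eq_sym.
  have d3423 : A * w3 * w4 != A * w2 * w3 by rewrite [A * w2 * w3]mulrAC cancel // eq_sym.
  by rewrite /= !inE !negb_or d1214 d1223 d3414 d3423 eq_sym ne34 eq_sym ne23.
have s_rM : perm_eq rM [:: A * w1 * w2; A * w3 * w4; A * w1 * w4; A * w2 * w3].
  rewrite perm_sym; apply: uniq_perm => //.
  apply: (uniq_min_size s_uniq _ _).2; last by rewrite rM_size.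
  have rMP x : root (pZtoF M) x -> x \in rM by rewrite ME root_prod_XsubC.
  by move=> x; rewrite !inE => /or4P[]/eqP->; apply: rMP.
split; first by rewrite ME (perm_big _ s_rM).
exists T; apply: (addIr (\sum_(w <- rM) w)); rewrite sumE (perm_big _ s_rM) /=.
by rewrite !big_cons !big_nil; ring.
Qed.

End QuarticResolvent.

(** * The discriminant class and the relations for the roots *)

Section QuarticStructure.
Variable F : numClosedFieldType.
Implicit Types P M : {poly int}.

Local Notation pZtoQ := (map_poly (intr : int -> rat)).
Local Notation pZtoF := (map_poly (intr : int -> F)).

(* If N = x_1 x_3 = x_2 x_4 for the roots x_i of the monic quartic M, this is ((x_1 - x_3) (x_2 - x_4)) ^ 2. *)
Definition pairing_disc M (N : int) :=
  (M`_2 + 2 * N) * (M`_2 + 2 * N) - 4 * N * (M`_3 * M`_3).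

(* The discriminant of the quadratic satisfied by A w_1 w_3 lies in the square class of pairing_disc M N, which depends on M and N only. *)
Lemma paired_quartic_disc P M (w1 w2 w3 w4 : F) (T : int) (A : F := (P`_4)%:~R)
    (N := P`_4 * P`_0) :
  pZtoF P = A *: \prod_(w <- [:: w1; w2; w3; w4]) ('X - w%:P) ->
  pZtoF M = \prod_(w <- [:: A * w1 * w2; A * w3 * w4; A * w1 * w4; A * w2 * w3]) ('X - w%:P) ->
  uniq [:: A * w1 * w2; A * w3 * w4; A * w1 * w4; A * w2 * w3] ->
  T%:~R = A * w1 * w3 + A * w2 * w4 ->
  [/\ M`_0 = N * N, pairing_disc M N != 0
    & exists G, (T * T - 4 * N) * pairing_disc M N = G * G].
Proof.
move=> PE ME uE TE; have NE : N%:~R = A * A * (w1 * w2 * w3 * w4) := norm_P_roots PE.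
clearbody N; have [c0 c1 c2 c3] := coef_prod4 w1 w2 w3 w4.
have cP i : (P`_i)%:~R = A * (\prod_(w <- [:: w1; w2; w3; w4]) ('X - w%:P))`_i.
  by rewrite -coefZ -PE coef_map.
have [m0 m1 m2 m3] := coef_prod4 (A * w1 * w2) (A * w3 * w4) (A * w1 * w4) (A * w2 * w3).
have cM i : (M`_i)%:~R = (pZtoF M)`_i by rewrite coef_map.
rewrite ME in cM.
have dE : (pairing_disc M N)%:~R =
    ((A * w1 * w2 - A * w3 * w4) * (A * w1 * w4 - A * w2 * w3)) ^+ 2.
  by rewrite /pairing_disc !(rmorphB, rmorphD, rmorphM) /= !cM NE m2 m3; ring.
split.
- apply: (@intr_inj F); rewrite cM m0 rmorphM /= NE; ring.
- rewrite -(@intr_eq0 F) dE expf_neq0 // mulf_neq0 // subr_eq0.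
    by move: uE; rewrite /= !inE !negb_or => /andP[/and3P[]].
  by move: uE; rewrite /= !inE !negb_or => /and4P[].
(* Up to sign this is A^3 (w1 w2 - w3 w4) (w1 w3 - w2 w4) (w1 w4 - w2 w3), which is symmetric in the
   roots. *)
- exists (P`_4 * (P`_1 * P`_1) - P`_0 * (P`_3 * P`_3)); apply: (@intr_inj F).
  rewrite [LHS]rmorphM /= dE !(rmorphB, rmorphM) /= TE NE (cP 0) (cP 1) (cP 3) c0 c1 c3.
  by rewrite -/A; ring.
Qed.

(** After exchanging w3 and w4 if need be, A w1 v4 is a root of M. The relations are identities such
    as A (A w2 v3) w1^2 = (A w1 v3) (A w1 w2); they leave finitely many a for given M, A, N, T. *)
Lemma quartic_structure P M (w1 w2 w3 w4 : F) (A : F := (P`_4)%:~R) (N := P`_4 * P`_0) :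
  pZtoF P = A *: \prod_(w <- [:: w1; w2; w3; w4]) ('X - w%:P) ->
  uniq [:: w1; w2; w3; w4] -> P`_4 != 0 -> P`_0 != 0 ->
  irreducible_poly (pZtoQ M) -> zcontents M = 1 -> size M = 5%N ->
  root (pZtoF M) (A * w1 * w2) ->
  exists v3 v4 (T : int), [/\ perm_eq [:: w3; w4] [:: v3; v4],
    T%:~R = A * w1 * v3 + A * w2 * v4,
    M`_0 = N * N,
    pairing_disc M N != 0 /\ (exists G, (T * T - 4 * N) * pairing_disc M N = G * G)
    & forall a, a \in [:: w1; w2; w3; w4] -> exists nu x y,
      [/\ nu * nu - T%:~R * nu + N%:~R = 0, root (pZtoF M) x, root (pZtoF M) y, y != 0
        & A * y * (a * a) = nu * x]].
Proof.
move=> PE w_uniq P4 P0 irr cM sM M12.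
suff H v3 v4 : perm_eq [:: w3; w4] [:: v3; v4] -> root (pZtoF M) (A * w1 * v4) ->
  exists T : int, [/\ T%:~R = A * w1 * v3 + A * w2 * v4, M`_0 = N * N,
    pairing_disc M N != 0 /\ (exists G, (T * T - 4 * N) * pairing_disc M N = G * G)
    & forall a, a \in [:: w1; w2; w3; w4] -> exists nu x y,
      [/\ nu * nu - T%:~R * nu + N%:~R = 0, root (pZtoF M) x, root (pZtoF M) y, y != 0
        & A * y * (a * a) = nu * x]].
  have [M14|M13] := resolvent_third_root PE P4 P0 irr cM sM M12.
    have [T [? ? ? ?]] := H w3 w4 (perm_refl _) M14.
    by exists w3, w4, T; split.
  have p34 : perm_eq [:: w3; w4] [:: w4; w3] by rewrite -[[:: w4; w3]]/(rot 1 [:: w3; w4]) perm_sym perm_rot.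
  have [T [? ? ? ?]] := H w4 w3 p34 M13.
  by exists w4, w3, T; split.
move=> pv M14.
have pw : perm_eq [:: w1; w2; w3; w4] [:: w1; w2; v3; v4] by rewrite !perm_cons.
have PEv : pZtoF P = A *: \prod_(w <- [:: w1; w2; v3; v4]) ('X - w%:P).
  by rewrite PE (perm_big _ pw).
have uv : uniq [:: w1; w2; v3; v4] by rewrite -(perm_uniq pw).
have [ME [T TE]] := resolvent_pairs PEv P4 P0 irr cM sM M12 uv M14.
have uM := irreducible_uniq_roots irr (oner_neq0 F) (etrans ME (esym (scale1r _))).
have [e1 e2 e3] := paired_quartic_disc PEv ME uM TE.
exists T; split=> // a; rewrite (perm_mem pw).
have NE : N%:~R = A * A * (w1 * w2 * v3 * v4) := norm_P_roots PEv.
have Mr x : x \in [:: A * w1 * w2; A * v3 * v4; A * w1 * v4; A * w2 * v3] -> root (pZtoF M) x.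
  by rewrite ME root_prod_XsubC.
have N0 : N%:~R != 0 :> F by rewrite intr_eq0 mulf_neq0.
have A0 : A != 0 by rewrite intr_eq0.
have : w1 * w2 * v3 * v4 != 0 by apply: contra_neq N0; rewrite NE => ->; rewrite mulr0.
rewrite !mulf_eq0 !negb_or => /andP[/andP[/andP[h1 h2] h3] h4].
rewrite !inE => /or4P[]/eqP->.
- exists (A * w1 * v3), (A * w1 * w2), (A * w2 * v3); split; rewrite ?mulf_neq0 //.
  + by rewrite TE NE; ring.
  + by apply: Mr; rewrite !inE eqxx !orbT.
  + by ring.
- exists (A * w2 * v4), (A * w1 * w2), (A * w1 * v4); split; rewrite ?mulf_neq0 //.
  + by rewrite TE NE; ring.
  + by ring.
- exists (A * w1 * v3), (A * w2 * v3), (A * w1 * w2); split; rewrite ?mulf_neq0 //.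
  + by rewrite TE NE; ring.
  + by apply: Mr; rewrite !inE eqxx !orbT.
  + by ring.
- exists (A * w2 * v4), (A * w1 * v4), (A * w1 * w2); split; rewrite ?mulf_neq0 //.
  + by rewrite TE NE; ring.
  + by ring.
Qed.

End QuarticStructure.

(** * Quartics with two roots outside the unit disk *)

Section QuarticHeight.
Variable F : numClosedFieldType.
Implicit Types P M : {poly int}.

Local Notation pZtoQ := (map_poly (intr : int -> rat)).
Local Notation pZtoF := (map_poly (intr : int -> F)).

Lemma conj_roots_perm P (c : int) (rs : seq F) : c != 0 ->
  pZtoF P = c%:~R *: \prod_(w <- rs) ('X - w%:P) ->
  perm_eq [seq w^* | w <- rs] rs.
Proof.
move=> c0 PE; apply: prod_XsubC_eq.
have cF : (c%:~R : F) != 0 by rewrite intr_eq0.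
apply: (scalerI cF); rewrite -PE big_map -(map_prod_XsubC (Num.conj : {rmorphism F -> F})).
have := congr1 (map_poly Num.conj) PE; rewrite map_polyZ /= rmorph_int => <-.
rewrite -map_poly_comp; apply: eq_map_poly => x /=; exact: rmorph_int.
Qed.

(** Conjugation permutes the roots and preserves their absolute values. *)
Lemma outer_roots_prod_real P (c : int) (rs : seq F) : c != 0 ->
  pZtoF P = c%:~R *: \prod_(w <- rs) ('X - w%:P) ->
  \prod_(w <- rs | ~~ (`|w| < 1)) w \is Num.real.
Proof.
move=> c0 PE; rewrite CrealE rmorph_prod /=.
rewrite -[X in _ == X](perm_big _ (conj_roots_perm c0 PE)) big_map /=.
by under [X in _ == X]eq_bigl => w do rewrite norm_conjC.
Qed.

Lemma quartic_height_structure P M (rs : seq F) (h : F) :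
  irreducible_poly (pZtoQ P) -> zcontents P = 1 -> size P = 5%N ->
  pZtoF P = (lead_coef P)%:~R *: \prod_(w <- rs) ('X - w%:P) ->
  count (fun w => `|w| < 1) rs = 2%N ->
  h = (lead_coef P)%:~R * \prod_(w <- rs | ~~ (`|w| < 1)) `|w| ->
  irreducible_poly (pZtoQ M) -> zcontents M = 1 -> size M = 5%N -> root (pZtoF M) h ->
  exists A N T : int, [/\ N != 0 /\ (A %| N)%Z, `|N%:~R| <= h * h /\ `|T%:~R| <= 2 * h,
    M`_0 = N * N,
    pairing_disc M N != 0 /\ (exists G, (T * T - 4 * N) * pairing_disc M N = G * G)
    & forall a, a \in rs -> exists nu x y,
      [/\ nu * nu - T%:~R * nu + N%:~R = 0, root (pZtoF M) x, root (pZtoF M) y, y != 0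
        & A%:~R * y * (a * a) = nu * x]].
Proof.
move=> irrP cP sP PE count2 hE irr cM sM Mh.
have lead0 : lead_coef P != 0 by rewrite lead_coef_eq0 -size_poly_eq0 sP.
have lead_gt0 : 0 < lead_coef P by rewrite -sgz_gt0 -sgz_contents cP.
have z_real := outer_roots_prod_real lead0 PE.
have rs_size : size rs = 4%N.
  have := congr1 (fun p : {poly F} => size p) PE.
  rewrite size_scale ?intr_eq0 // size_prod_XsubC size_map_inj_poly ?sP => [[]|//|] //.
  exact: intr_inj.
have rs_uniq : uniq rs by apply: (irreducible_uniq_roots irrP _ PE); rewrite intr_eq0.
have rs_perm := permEl (perm_filterC (fun w : F => ~~ (`|w| < 1)) rs).
have := count_predC (fun w : F => `|w| < 1) rs; rewrite rs_size count2 => /(@addnI 2 _ 2) cnt.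
rewrite -big_filter in z_real; rewrite -big_filter in hE.
have outP : all (fun w => ~~ (`|w| < 1)) [seq w <- rs | ~~ (`|w| < 1)] by apply: filter_all.
have inP : all (fun w => `|w| < 1) [seq w <- rs | predC (fun w => ~~ (`|w| < 1)) w].
  by apply: sub_all (filter_all _ _) => w /=; rewrite negbK.
have so : size [seq w <- rs | ~~ (`|w| < 1)] = 2%N by rewrite size_filter cnt.
have si : size [seq w <- rs | predC (fun w => ~~ (`|w| < 1)) w] = 2%N.
  by rewrite size_filter -count2; apply: eq_count => w /=; rewrite negbK.
move: so si outP inP z_real hE rs_perm.
case: [seq w <- rs | ~~ (`|w| < 1)] => [|w1 [|w2 []]] //.
case: [seq w <- rs | predC (fun w => ~~ (`|w| < 1)) w] => [|w3 [|w4 []]] // _ _.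
rewrite !big_cons !big_nil !mulr1 => /and3P[out1 out2 _] /and3P[in3 in4 _] z_real hE.
rewrite perm_sym => rs_perm.
have le1 (w : F) : ~~ (`|w| < 1) -> 1 <= `|w| by rewrite real_ltNge ?negbK ?num_real ?normr_real ?real1.
have {}out1 := le1 _ out1; have {}out2 := le1 _ out2.
have {}in3 := ltW in3; have {}in4 := ltW in4.
rewrite -normrM in hE.
(* As w1 w2 is real, |w1 w2| = s w1 w2 for a sign s; passing to P' = s P, with leading coefficient
   A, makes h equal to A w1 w2. *)
have [s sE hs] : exists2 s : int, `|s| = 1 & h = (s * lead_coef P)%:~R * w1 * w2.
  have [z0|z0] := real_ge0P z_real.
    by exists 1 => //; rewrite mul1r hE ger0_norm // mulrA.
  exists (-1); rewrite ?normrN1 // hE ltr0_norm // mulN1r rmorphN /=; ring.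
have s0 : s != 0 by move: sE; case: eqP => // ->.
pose P' := s *: P.
have P'4 : P'`_4 = s * lead_coef P by rewrite coefZ /lead_coef sP.
have P'E : pZtoF P' = (P'`_4)%:~R *: \prod_(w <- [:: w1; w2; w3; w4]) ('X - w%:P).
  by rewrite map_polyZ PE /= scalerA -rmorphM P'4 (perm_big _ rs_perm).
have P'4_neq0 : P'`_4 != 0 by rewrite P'4 mulf_neq0.
have P'0_neq0 : P'`_0 != 0.
  rewrite coefZ mulf_neq0 //; apply/eqP => P0.
  have Proot : root (pZtoF P) 0 by rewrite rootE horner_coef0 coef_map /= P0.
  have Xroot : root (pZtoF 'X) 0 by rewrite map_polyX rootE hornerX.
  by have := irreducible_root_size irrP Proot Xroot; rewrite sP size_polyX polyX_eq0 => /(_ isT).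
have w_uniq : uniq [:: w1; w2; w3; w4] by rewrite -(perm_uniq rs_perm).
rewrite hs -P'4 in Mh.
have [v3 [v4 [T [pv TE MN disc rel]]]] :=
  quartic_structure P'E w_uniq P'4_neq0 P'0_neq0 irr cM sM Mh.
set N := _ * P'`_0 in MN disc rel; set A : F := (P'`_4)%:~R in TE rel P'E.
have hA : h = `|A| * `|w1| * `|w2|.
  rewrite hE normrM mulrA; congr (_ * _ * _).
  by rewrite /A -intr_norm P'4 normrM sE mul1r gtr0_norm.
have inv w : w \in [:: v3; v4] -> `|w| <= 1.
  by rewrite -(perm_mem pv) !inE => /orP[]/eqP->.
have {}in3 : `|v3| <= 1 by apply: inv; rewrite mem_head.
have {}in4 : `|v4| <= 1 by apply: inv; rewrite !inE eqxx orbT.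
have A_ge0 : 0 <= `|A| by [].
(* Each summand of T pairs an outer root with an inner one; replacing the inner root by the other
   outer root bounds it by h. *)
have T1 : `|A * w1 * v3| <= h.
  by rewrite hA !normrM; apply: ler_pM; rewrite ?mulr_ge0 // (le_trans in3).
have T2 : `|A * w2 * v4| <= h.
  by rewrite hA [leRHS]mulrAC !normrM; apply: ler_pM; rewrite ?mulr_ge0 // (le_trans in4).
have NE : N%:~R = (A * w1 * w2) * (A * v3 * v4) :> F.
  rewrite (norm_P_roots P'E) -/A; have : w3 * w4 = v3 * v4.
    by have := perm_big _ pv (op := *%R) (x := 1) (P := xpredT) (F := id); rewrite !big_cons !big_nil /= !mulr1.
  by move=> E; rewrite -(mulrA _ w3) E; ring.
have h34 : `|A * v3 * v4| <= h.
  rewrite hA !normrM; apply: ler_pM; rewrite ?mulr_ge0 ?(le_trans in4) //.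
  by apply: ler_pM; rewrite ?(le_trans in3).
exists P'`_4, N, T; split=> //.
- by split; [rewrite mulf_neq0 | rewrite dvdz_mulr].
- split; first by rewrite NE normrM ler_pM // hA !normrM.
  by rewrite TE (le_trans (ler_normD _ _)) // mulrDl mul1r lerD.
- by move=> a; rewrite (perm_mem rs_perm) => /rel.
Qed.

End QuarticHeight.

(** * Counting *)

Section CountStructured.
Variable F : numClosedFieldType.

Local Notation pZtoF := (map_poly (intr : int -> F)).

Lemma at_most_root (p : {poly F}) : p != 0 -> at_most (fun z => root p z) (size p).-1.
Proof.
move=> p0 s us sp; have : all (root p) s by apply/allP.
by move/max_poly_roots => /(_ p0 us); case: (size p) => //.
Qed.

Lemma at_most_quadratic_root (b c : F) : at_most (fun z => z * z - b * z + c = 0) 2.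
Proof.
apply: at_most_witness => z0 E0; apply: (@at_most_seq _ [:: z0; b - z0]) => // z E.
have : (z - z0) * (z - (b - z0)) == 0.
  rewrite (_ : _ * _ = (z * z - b * z + c) - (z0 * z0 - b * z0 + c)); last by ring.
  by rewrite E E0 subrr.
by rewrite mulf_eq0 subr_eq0 subr_eq0 !inE.
Qed.

Lemma at_most_sqrt (c : F) : at_most (fun z => z * z = c) 2.
Proof.
move=> s us sP; apply: (@at_most_quadratic_root 0 (- c) s us) => z /sP <-.
by rewrite mul0r subr0 subrr.
Qed.

Variable (M : {poly int}).
Hypothesis M_size : size M = 5%N.

Definition root_relation (T N A : int) (a : F) := exists nu x y : F,
  [/\ nu * nu - T%:~R * nu + N%:~R = 0, root (pZtoF M) x, root (pZtoF M) y, y != 0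
    & A%:~R * y * (a * a) = nu * x].

(** In 64 = 2 * 4 * 4 * 2 the factors count nu, x, y and the square root. *)
Lemma at_most_related (T N A : int) : A != 0 -> at_most (root_relation T N A) 64.
Proof.
move=> A0; have A0F : A%:~R != 0 :> F by rewrite intr_eq0.
have M0 : pZtoF M != 0.
  by rewrite map_poly_eq0_id0 ?intr_eq0 ?lead_coef_eq0 -size_poly_eq0 M_size.
have M_roots := at_most_root M0; rewrite size_map_inj_poly ?M_size //= in M_roots; last exact: intr_inj.
rewrite -[64%N]/(2 * (4 * (4 * 2)))%N.
apply: (at_most_bind (@at_most_quadratic_root T%:~R N%:~R) (Q := fun nu a => exists x y : F,
  [/\ root (pZtoF M) x, root (pZtoF M) y, y != 0 & A%:~R * y * (a * a) = nu * x])); last first.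
  by move=> a [nu [x [y [? ? ? ? ?]]]]; exists nu => //; exists x, y.
move=> nu _.
apply: (at_most_bind M_roots (Q := fun x a => exists y : F,
  [/\ root (pZtoF M) y, y != 0 & A%:~R * y * (a * a) = nu * x])); last first.
  by move=> a [x [y [? ? ? ?]]]; exists x => //; exists y.
move=> x _.
apply: (at_most_bind M_roots (Q := fun y a => y != 0 /\ A%:~R * y * (a * a) = nu * x)); last first.
  by move=> a [y [? ? ?]]; exists y.
move=> y _; have [->|y0] := eqVneq y 0.
  by apply: (at_most_witness) => a [].
move=> s us sP; apply: (@at_most_sqrt (nu * x / (A%:~R * y)) s us) => a /sP[_ <-].
by field; rewrite A0F y0.
Qed.

(** The conclusion of [quartic_height_structure] with X an integer upper bound for H^4. *)
Definition structured (X : nat) (a : F) := exists A N T : int,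
  [/\ N != 0 /\ (A %| N)%Z, (`|N| <= X * X)%N /\ (`|T| <= 2 * X)%N, M`_0 = N * N,
    pairing_disc M N != 0 /\ (exists G, (T * T - 4 * N) * pairing_disc M N = G * G)
    & root_relation T N A a].

(** With n = |N|, the factors stand for the sign of N, the signed divisor A, the trace T with |T| <=
    2 X, and the value a. *)
Definition structured_bound (X n : nat) :=
  (2 * (2 * tau n * (tau (4 * n) * (tau (4 * n) * unit_bound (4 * (2 * X * (2 * X)) + 2 * (4 * n))) * 64)))%N.

(** M determines |N|, since N^2 = M(0); the given element supplies its value n. *)
Lemma at_most_structured X a : structured X a ->
  exists n, [/\ (0 < n)%N, (n <= X * X)%N & at_most (structured X) (structured_bound X n)].
Proof.
move=> [_ [N0 [_ [[N00 _] [N0X _] MN0 _ _]]]]; exists `|N0|%N; split=> //; first by rewrite absz_gt0.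
apply: (at_most_bind (S := fun N : int => `|N|%N = `|N0|%N) (Q := fun N a => exists A T : int,
  [/\ (A %| N)%Z, (`|T| <= 2 * X)%N,
    pairing_disc M N != 0 /\ (exists G, (T * T - 4 * N) * pairing_disc M N = G * G)
    & root_relation T N A a])).
- by apply: (@at_most_seq _ [:: N0; - N0]) => // N NN; rewrite !inE; lia.
- move=> N NN; have N_neq0 : N != 0 by rewrite -absz_eq0 NN absz_eq0.
  apply: (at_most_bind (S := fun A : int => (A %| N)%Z) (Q := fun A a => exists T : int,
    [/\ (`|T| <= 2 * X)%N,
    pairing_disc M N != 0 /\ (exists G, (T * T - 4 * N) * pairing_disc M N = G * G)
    & root_relation T N A a])).
  + apply: (@at_most_seq _ (map Posz (divisors `|N0|) ++ map (fun d => - Posz d) (divisors `|N0|))).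
      by rewrite size_cat !size_map mul2n addnn.
    move=> A AN; have dA : `|A|%N \in divisors `|N0|%N.
      by rewrite -dvdn_divisors ?absz_gt0 // -NN.
    rewrite mem_cat; apply/orP; have [A0|A0] := lerP 0 A; [left|right].
      by apply/mapP; exists `|A|%N => //; rewrite gez0_abs.
    by apply/mapP; exists `|A|%N => //; rewrite ltz0_abs // opprK.
  + move=> A AN; have A0 : A != 0 by apply: contraTneq AN => ->; rewrite dvd0z.
    have [disc0|disc0] := eqVneq (pairing_disc M N) 0.
      by apply: at_most_witness => b [T [_ []]].
    (* D depends on M and N only, and T^2 - 4 N lies in its square class, so T^2 - D f^2 = 4 N for
       some f. *)
    have [D [g [sD g0 DE]]] := squarefree_decomposition disc0.
    have N4 : 4 * N != 0 by rewrite mulf_neq0.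
    have := @trace_count D (4 * N) (2 * X) sD N4; rewrite /key_bound abszM NN => HT.
    apply: (at_most_bind HT (Q := fun T => root_relation T N A)).
      by move=> T _; apply: at_most_related.
    move=> b [T [TX [_ [G GE]] rel]]; exists T => //; split=> //.
    by move: GE; rewrite DE => /(square_class sD g0)[f fE]; exists f; rewrite -fE; ring.
  + by move=> b [A [T [? ? ? ?]]]; exists A => //; exists T.
- move=> b [A [N [T [[? ?] [? ?] MN ? ?]]]]; exists N; last by exists A, T.
  by apply/eqP; rewrite -(eqn_exp2r _ _ (isT : (0 < 2)%N)) -!mulnn -!abszM -MN -MN0.
Qed.

End CountStructured.

(** * Size of the bound *)

Lemma structured_bound_expn_le K : exists c, forall X n,
  (0 < n)%N -> (n <= X * X)%N -> (structured_bound X n ^ K <= c * X ^ 8)%N.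
Proof.
have [c c0 tauK] := tau_expn_le K.
(* Here 96 * 64 = 2 * 2 * 24 * 64, as [unit_bound] is at most 24 (L + 1) for the logarithm L of 24
   X^2 >= 16 X^2 + 8 n. The K-th powers of the three [tau] and of L + 1 are each O(X^2), whence
   X^8. *)
exists ((96 * 64) ^ K * (c * 4) ^ 3 * (K ^ K * 24))%N => X n n0 nX.
have X0 : (0 < X)%N by case: X nX => //; lia.
have tn : (tau n <= tau (4 * n))%N by apply: tau_dvd; rewrite ?dvdn_mull // muln_gt0.
have un : (unit_bound (4 * (2 * X * (2 * X)) + 2 * (4 * n)) <= 24 * (trunc_log 2 (24 * (X * X))).+1)%N.
  rewrite /unit_bound; have := @leq_trunc_log 2 (4 * (2 * X * (2 * X)) + 2 * (4 * n)) (24 * (X * X)).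
  by move=> H; have {}H : (trunc_log 2 (4 * (2 * X * (2 * X)) + 2 * (4 * n)) <= trunc_log 2 (24 * (X * X)))%N
    by [apply: H; lia]; lia.
set L := trunc_log 2 _ in un.
apply: leq_trans (_ : ((96 * 64) * (tau (4 * n) ^ 3 * L.+1)) ^ K <= _)%N.
  apply: leq_base_expn; rewrite /structured_bound.
  apply: leq_trans (_ : 2 * (2 * tau (4 * n) * (tau (4 * n) * (tau (4 * n) * (24 * L.+1)) * 64)) <= _)%N.
    by rewrite leq_mul2l /=; apply: leq_mul; [lia | rewrite leq_mul2r !leq_mul2l un !orbT].
  by move: (tau (4 * n)) L.+1 => t l; apply: eq_leq; ring.
have tK : ((tau (4 * n)) ^ K <= c * 4 * X ^ 2)%N.
  by apply: leq_trans (tauK _ _) _; rewrite ?muln_gt0 // -mulnA !leq_mul2l -mulnn nX !orbT.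
have LK : (L.+1 ^ K <= K ^ K * 24 * X ^ 2)%N.
  by apply: leq_trans (trunc_log_expn_le _ _) _; rewrite ?muln_gt0 ?X0 // -mulnA mulnn.
have -> : ((96 * 64 * (tau (4 * n) ^ 3 * L.+1)) ^ K =
    (96 * 64) ^ K * ((tau (4 * n) ^ K) ^ 3 * L.+1 ^ K))%N.
  by move: (96 * 64)%N (tau _) L.+1 => a t l; rewrite expnMn (expnMn (t ^ 3)%N) -expnM (mulnC 3) expnM.
have -> : ((96 * 64) ^ K * (c * 4) ^ 3 * (K ^ K * 24) * X ^ 8 =
    (96 * 64) ^ K * ((c * 4 * X ^ 2) ^ 3 * (K ^ K * 24 * X ^ 2)))%N.
  rewrite -[8%N]/(2 * 4)%N (expnM X).
  by move: ((96 * 64) ^ K)%N (K ^ K)%N (X ^ 2)%N => a b x; ring.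
by rewrite leq_mul2l; apply/orP; right; apply: leq_mul => //; apply: leq_base_expn.
Qed.

(** * From A(2, 4, H) to the structured elements *)

Section CountHeight.
Variable R : realType.
Local Notation C := R[i].
Local Notation pZtoC := (map_poly (intr : int -> C)).

Lemma norm_lt1 (w : C) : (`|w| < 1) = (Normc.normc w < 1).
Proof. by rewrite -ltcR. Qed.

(** The clauses of [inA] carry separate polynomials, identified by uniqueness of the minimal
    polynomial. Inner roots contribute 1 to the height, so H^4 is a_0 times the product of |w| over
    the outer roots. *)
Lemma inA_structured (H : R) (M : {poly int}) (X : nat) (a : C) :
  1 <= H -> minpolyZ ((H%:C)%C ^+ 4) M -> size M = 5%N -> H ^+ 4 <= X%:R ->
  inA 2 4 H a -> structured M X a.
Proof.
move=> H1 [cM irrM rootM] sM HX [[P [[cP irrP rootP] dP]]].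
move=> [P1 [rs1 [[cP1 irrP1 rootP1] cj1 HE]]] [P2 [rs [[cP2 irrP2 rootP2] cj count2]]].
have E1 : P = P1 := primitive_irreducible_eq irrP cP rootP irrP1 cP1 rootP1.
have E2 : P = P2 := primitive_irreducible_eq irrP cP rootP irrP2 cP2 rootP2.
subst P1 P2; have sP : size P = 5%N by move: dP; case: (size P) => // n /= ->.
have lead0 : lead_coef P != 0 by rewrite lead_coef_eq0 -size_poly_eq0 sP.
have lead_gt0 : 0 < lead_coef P by rewrite -sgz_gt0 -sgz_contents cP.
have rs_perm : perm_eq rs1 rs.
  apply: prod_XsubC_eq; have l0 : (lead_coef P)%:~R != 0 :> C by rewrite intr_eq0.
  by apply: (scalerI l0); rewrite -cj1 -cj.
rewrite (perm_big _ rs_perm) /= sP in HE.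
have H4 : H ^+ 4 = (lead_coef P)%:~R * \prod_(w <- rs) Num.max 1 (Normc.normc w).
  rewrite -powR_mulrn ?(le_trans ler01) // HE -powRrM mulVf ?pnatr_eq0 // powRr1 //.
  apply: mulr_ge0; first by rewrite ler0z ltW.
  apply: prodr_ge0 => w _.
  by rewrite le_max ler01.
have hE : (H%:C)%C ^+ 4 = (lead_coef P)%:~R * \prod_(w <- rs | ~~ (`|w| < 1)) `|w|.
  rewrite -rmorphXn /= H4 rmorphM rmorph_int /= rmorph_prod /=; congr (_ * _).
  rewrite [RHS]big_mkcond /=; apply: eq_bigr => w _.
  rewrite norm_lt1 -leNgt maxEle.
  by case: leP.
have count2' : count (fun w : C => `|w| < 1) rs = 2%N.
  by rewrite -{}count2; apply: eq_count => w; rewrite norm_lt1.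
have [A [N [T [AN [NB TB] MN disc rel]]]] :=
  quartic_height_structure irrP cP sP cj count2' hE irrM cM sM rootM.
have hX : (H%:C)%C ^+ 4 <= X%:R :> C.
  by rewrite -rmorphXn /= -[X%:R](rmorph_nat (real_complex R)) lecR.
have h0 : 0 <= (H%:C)%C ^+ 4 :> C.
  by rewrite -rmorphXn /= -[0]/((0 : R)%:C)%C lecR exprn_ge0 // (le_trans ler01).
exists A, N, T; split=> //.
- split.
    rewrite -(ler_nat C) natrM natr_absz intr_norm; apply: le_trans NB _.
    by apply: ler_pM.
  rewrite -(ler_nat C) natrM natr_absz intr_norm; apply: le_trans TB _.
  by rewrite ler_wpM2l.
- apply: rel; rewrite -root_prod_XsubC.
  by move: rootP; rewrite cj rootZ // intr_eq0.
Qed.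

End CountHeight.

Theorem theorem6p1 (R : realType) (eps : R) :
  0 < eps ->
  exists Cst : R,
    forall H : R,
      algebraic (H%:C)%C -> 1 <= H -> alg_degree ((H%:C)%C ^+ 4) 4 ->
      forall s : seq R[i], uniq s -> (forall a, a \in s -> inA 2 4 H a) ->
        (size s)%:R <= Cst * H `^ eps.
Proof.
move=> eps0.
(* The K-th power of the count will be at most c X^8 <= c (2 H^4)^8 = c 2^8 H^32, and 32 <= eps
   K. *)
pose K := (Num.trunc (32 / eps)).+1.
have K32 : 32 <= eps * K%:R.
  by rewrite -ler_pdivrMl // mulrC; apply: ltW; rewrite /K truncnS_gt.
have [c cK] := structured_bound_expn_le K.
(* The added 1 makes the constant at least 1, hence at most its own K-th power. *)
exists ((c * 2 ^ 8)%:R + 1) => H _ H1 [M [minM dM]] s us sA.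
have sM : size M = 5%N by move: dM; case: (size M) => // n /= ->.
have H40 : 1 <= H ^+ 4 by rewrite exprn_ege1.
pose X := (Num.trunc (H ^+ 4)).+1.
have HX : H ^+ 4 <= X%:R by rewrite ltW // truncnS_gt.
have X2 : X%:R <= 2 * H ^+ 4.
  rewrite /X -natr1 mulr2n mulrDl mul1r lerD // truncn_le //.
  by rewrite (le_trans ler01).
have B0 : 0 <= ((c * 2 ^ 8)%:R + 1) * H `^ eps by rewrite mulr_ge0 ?powR_ge0 // addr_ge0.
(* The value n below is read off from a member of s, so the empty list is treated apart. *)
have [->|[a as_]] : s = [::] \/ exists a, a \in s.
  by case: (s) => [|a t]; [left | right; exists a; rewrite mem_head].
- exact: B0.
have [n [n0 nX sn]] := at_most_structured sM (inA_structured H1 minM sM HX (sA a as_)).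
have size_s : (size s <= structured_bound X n)%N.
  by apply: sn us _ => b /sA; apply: inA_structured.
have : (size s ^ K <= c * X ^ 8)%N by apply: leq_trans (cK X n n0 nX); apply: leq_base_expn.
rewrite -(ler_nat R) natrX natrM natrX => sK.
rewrite -(@ler_pXn2r _ K) // ?nnegrE //; apply: le_trans sK _.
apply: (@le_trans _ _ (c%:R * (2 * H ^+ 4) ^+ 8)).
  by rewrite ler_wpM2l // lerXn2r ?nnegrE // mulr_ge0 // (le_trans ler01).
have -> : c%:R * (2 * H ^+ 4) ^+ 8 = (c * 2 ^ 8)%:R * H ^+ 32 :> R by rewrite natrM natrX; ring.
rewrite exprMn; apply: ler_pM; rewrite ?exprn_ge0 ?(le_trans ler01 H1) //.
  apply: (@le_trans _ _ ((c * 2 ^ 8)%:R + 1)); first by rewrite lerDl.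
  by rewrite -{1}[_ + 1]expr1 ler_weXn2l // lerDr.
rewrite -powR_mulrn ?(le_trans ler01) // -powR_mulrn ?powR_ge0 // -powRrM.
by apply: ler_powR.
Qed.
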